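(* Let $X,Y,Z,W$ be reflexive Banach spaces ($X,Y,Z$ real), let $U$ be a nonempty weakly closed subset of $W$, and let $\pi:X\to Z$ be linear, continuous and completely continuous (i.e. $v_n\rightharpoonup v$ in $X$ implies $\pi v_n\to\pi v$ in $Z$). For each $p\in U$ let $(A_p,b_p,J_p,f_p,\Lambda_p)$ be an admissible data tuple (defined in the context) with function $h_p$ and constants $r_p,\alpha_p,c_p,M_p,q_p,m_p$ (and local Lipschitz constants $L^p_S$), and let $(u_p,\lambda_p)\in X\times\Lambda_p$ be the unique solution of the mixed problem with these data. Let $\mathcal L:X\times Y\times U\to\mathbb R$ be such that, for all sequences $\{u_n\}\subset X$, $\{\lambda_n\}\subset Y$, $\{p_n\}\subset U$ with $u_n\to u$ in $X$, $\lambda_n\rightharpoonup\lambda$ in $Y$, $p_n\rightharpoonup p$ in $W$, one has $\liminf_{n\to\infty}\mathcal L(u_n,\lambda_n,p_n)\ge\mathcal L(u,\lambda,p)$. Assume that at least one of the following holds: (A) there exists $\psi:U\to\mathbb R$ with $\mathcal L(u,\lambda,p)\ge\psi(p)$ for all $u\in X,\lambda\in Y,p\in U$, and such that for $\{p_n\}\subset U$, $\|p_n\|_W\to+\infty$ implies $\psi(p_n)\to\infty$; (B) $U$ is a bounded subset of $W$. Assume in addition that for every sequence $\{p_n\}\subset U$ with $p_n\rightharpoonup p$ in $W$ the following conditions hold: (a) there exist $\widetilde\delta$ and, for each $n$, numbers $F_n\ge0$, $\delta_n\ge0$ such that $\|A_{p_n}v-A_pv\|_{X'}\le F_n(\|v\|_X+\delta_n)$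 for all $v\in X$, $\lim F_n=0$, and $\delta_n\le\widetilde\delta$ for all $n$; (b) for each $w\in X$ the map $v\mapsto J_p(w,v)$ is weakly lower semicontinuous on $X$, and for each sequence $w_n\rightharpoonup \widetilde w$ in $X$ one has $\limsup[J_p(\widetilde w,w_n-\widetilde w)-J_{p_n}(\widetilde w,w_n-\widetilde w)]\le0$ and $\limsup[J_{p_n}(w_n,v-w_n)-J_p(w_n,v-w_n)]\le0$ for all $v\in X$; (c) there exists $M_0>0$ with $M_{p_n}-m_{p_n}\ge M_0$ for all $n$; (d) there exists $\widetilde q>0$ with $q_{p_n}\ge\widetilde q$ for all $n$; (e) there exists $\widetilde c$ with $c_{p_n}\le\widetilde c$ for all $n$; (f) for all sequences $z_n\rightharpoonup z$ in $X$ and $\mu_n\rightharpoonup\mu$ in $Y$, $\limsup b_{p_n}(w-z_n,\mu_n)\le b_p(w-z,\mu)$ for all $w\in X$; (g) there exists $\alpha_0>0$ with $\alpha_{p_n}\ge\alpha_0$ for all $n$; (h) $\Lambda_{p_n}$ converges to $\Lambda_p$ in the sense of Mosco: for each $\mu\in\Lambda_p$ there is a sequence $\{\mu_n\}$ with $\mu_n\in\Lambda_{p_n}$ for each $n$ and $\mu_n\to\mu$ in $Y$; and for each sequence $\{\mu_n\}$ with $\mu_n\in\Lambda_{p_n}$ for each $n$ and $\mu_n\rightharpoonup\mu$ in $Y$, one has $\mu\in\Lambda_p$; (i) $f_{p_n}\rightharpoonup f_p$ in $Z'$. Then there exists at least one $p^*\in U$ such that $$\mathcal L(u_{p^*},\lambda_{p^*},p^*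 )=\min_{p\in U}\mathcal L(u_p,\lambda_p,p).$$
   Context: $(\cdot,\cdot)_{X',X}$, $(\cdot,\cdot)_{Z',Z}$ denote duality pairings; $\to$ and $\rightharpoonup$ denote strong and weak convergence; limits are as $n\to\infty$. Mixed problem with data $(A,b,J,f,\Lambda)$ (and fixed $\pi$): find $(u,\lambda)\in X\times\Lambda$ such that $$(Au,v-u)_{X',X}+b(v-u,\lambda)+J(u,v-u)\ge (f,\pi(v-u))_{Z',Z}\quad\forall v\in X,\qquad b(u,\mu-\lambda)\le0\quad\forall\mu\in\Lambda.$$ Admissible data tuple: $A:X\to X'$, $b:X\times Y\to\mathbb R$, $J:X\times X\to\mathbb R$, $f\in Z'$, $\Lambda\subset Y$ such that, for some function $h$ and constants $r,\alpha,c,M,q,m$: (1) $h:X\to\mathbb R$ and $r>1$ satisfy: $h(tw)=t^rh(w)$ for all $t>0$, $w\in X$; $(Av-Au,v-u)_{X',X}\ge h(v-u)$ for all $u,v\in X$; $w_k\rightharpoonup w$ in $X$ implies $h(w)\le\limsup_k h(w_k)$; (2) $A$ is continuous; (3) $(Au,u)_{X',X}/\|u\|_X\to\infty$ as $\|u\|_X\to\infty$; (4) $b$ is bilinear; $w_k\rightharpoonup w$ in $X$ implies $b(w_k,\mu)\to b(w,\mu)$ for all $\mu\in Y$; $\mu_k\rightharpoonup\mu$ in $Y$ implies $b(v,\mu_k)\to b(v,\mu)$ for all $v\in X$; $\alpha>0$ and $\inf_{\mu\in Y,\mu\ne0}\sup_{v\in X,v\ne0}\frac{b(v,\mu)}{\|v\|_X\|\mu\|_Y}\ge\alpha$;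 (5) for every $u\in X$, $v\mapsto J(u,v)$ is positively homogeneous and subadditive; $c>0$ and $|J(u,v)|\le c\|v\|_X$ for all $u,v\in X$; $w_k\rightharpoonup w$, $v_k\rightharpoonup v$ in $X$ imply $\limsup_k J(w_k,v_k)\le J(w,v)$; (6) $\Lambda$ is a closed convex bounded subset of $Y$ containing $0_Y$; (7) $M>0$, $q\ge2$ and $h(v)\ge M\|v\|_X^q$ for all $v\in X$; (8) $m\ge0$ and $J(w_1,w_2-w_1)+J(w_2,w_1-w_2)\le m\|w_1-w_2\|_X^q$ for all $w_1,w_2\in X$; (9) $M>m$; (10) $J(u,v)+J(u,-v)\le0$ for all $u,v\in X$; (11) for each nonempty bounded $S\subset X$ there is $L_S>0$ with $\|Au-Av\|_{X'}\le L_S\|u-v\|_X$ for all $u,v\in S$. For linear continuous $\pi$ and an admissible data tuple, the mixed problem has a unique solution. *)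

(* Defs.v *)
From HB Require Import structures.
From mathcomp Require Import all_boot all_order all_algebra.
From mathcomp Require Import complex.
From mathcomp Require Import all_classical all_reals all_analysis.

Set Implicit Arguments.
Unset Strict Implicit.
Unset Printing Implicit Defensive.

Import Order.TTheory GRing.Theory Num.Theory.
Import numFieldNormedType.Exports.

Local Open Scope classical_set_scope.
Local Open Scope complex_scope.
Local Open Scope ring_scope.

(* A value of [scalar_field R K] says that K is R or its complexification. *)
Variant scalar_field (R : realType) : numFieldType -> Type :=
| RealScalars : scalar_field R R
| ComplexScalars : scalar_field R R[i].

Section scalars.
Context {R : realType}.

Definition modulus (K : numFieldType) (s : scalar_field R K) : K -> R :=
  match s in scalar_field _ K' return K' -> R with
  | RealScalars => fun x => `|x|
  | ComplexScalars => fun z => complex.Re `|z|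
  end.

Definition real_scalar (K : numFieldType) (s : scalar_field R K) : R -> K :=
  match s in scalar_field _ K' return R -> K' with
  | RealScalars => fun x => x
  | ComplexScalars => fun x => x%:C
  end.

Context (K : numFieldType) (s : scalar_field R K).

Lemma modulusK (x : K) : real_scalar s (modulus s x) = `|x|.
Proof. by case: s x => //= x; rewrite normc_def. Qed.

Lemma real_scalarD (a b : R) :
  real_scalar s (a + b) = real_scalar s a + real_scalar s b.
Proof. by case: s => //=; rewrite rmorphD. Qed.

Lemma real_scalarM (a b : R) :
  real_scalar s (a * b) = real_scalar s a * real_scalar s b.
Proof. by case: s => //=; rewrite rmorphM. Qed.

Lemma ler_real_scalar (a b : R) :
  (real_scalar s a <= real_scalar s b) = (a <= b).
Proof. by case: s => //=; rewrite lecR. Qed.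

Lemma real_scalar0 : real_scalar s 0 = 0.
Proof. by case: s. Qed.

Lemma real_scalar_inj : injective (real_scalar s).
Proof. by move=> a b ab; apply/eqP; rewrite eq_le -!ler_real_scalar ab lexx. Qed.

Lemma modulus_ge0 (x : K) : 0 <= modulus s x.
Proof. by rewrite -ler_real_scalar real_scalar0 modulusK. Qed.

Lemma modulusD (x y : K) : modulus s (x + y) <= modulus s x + modulus s y.
Proof. by rewrite -ler_real_scalar real_scalarD !modulusK ler_normD. Qed.

Lemma modulusM (x y : K) : modulus s (x * y) = modulus s x * modulus s y.
Proof. by apply: real_scalar_inj; rewrite real_scalarM !modulusK normrM. Qed.

Lemma real_scalar_nonneg (x : K) : 0 <= x -> real_scalar s (modulus s x) = x.
Proof. by move=> x0; rewrite modulusK ger0_norm. Qed.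

End scalars.

Definition is_functional (K : numFieldType) (V : normedModType K) :
    {pred (V -> K^o)} :=
  [pred f : V -> K^o | `[< linear f /\ continuous f >]].
Arguments is_functional {K} V.

(* [s] is only used to compute the norm. *)
Record dual (R : realType) (K : numFieldType) (s : scalar_field R K)
    (V : normedModType K) :=
  Dual { dual_fun :> V -> K^o ; dual_funP : dual_fun \in is_functional V }.

Section dual.
Context {R : realType} {K : numFieldType} (s : scalar_field R K).
Context (V : normedModType K).
Local Notation V' := (dual s V).

Lemma is_functional_submod : submod_closed (is_functional V).
Proof.
split=> [|a f g].
  apply/asboolP; split; last exact: cst_continuous.
  by move=> a x y; rewrite /= scaler0 addr0.
move=> /asboolP[fl fc] /asboolP[gl gc]; apply/asboolP; split.
  move=> b x y; rewrite !fctE fl gl !scalerDr addrACA; congr (_ + _ + _).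
  by rewrite !scalerA mulrC.
move=> x; apply: cvgD; last exact: gc.
by apply: cvgZr; exact: fc.
Qed.

HB.instance Definition _ :=
  GRing.isSubmodClosed.Build K (V -> K^o) (is_functional V) is_functional_submod.

HB.instance Definition _ := [isSub of V' for @dual_fun R K s V].
HB.instance Definition _ := [Choice of V' by <:].
HB.instance Definition _ := [SubChoice_isSubLmodule of V' by <:].

Lemma dual_linear (phi : V') : linear phi.
Proof. by have /asboolP[] := dual_funP phi. Qed.

Lemma dual_continuous (phi : V') : continuous phi.
Proof. by have /asboolP[] := dual_funP phi. Qed.

HB.instance Definition _ (phi : V') :=
  GRing.isLinear.Build K V K^o *:%R phi (dual_linear phi).

Definition dual_image (phi : V') : set R :=
  [set modulus s (phi x) | x in [set x : V | `|x| <= 1]].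

Definition dual_norm (phi : V') : K := real_scalar s (sup (dual_image phi)).

Lemma dual_bounded (phi : V') :
  exists C : R, forall x : V, `|phi x| <= real_scalar s C * `|x|.
Proof.
have /linear_boundedP : bounded_near phi (nbhs (0 : V)).
  by apply/linear_bounded_continuous; exact: dual_continuous.
move=> /pinfty_ex_gt0[r r0 Hr]; exists (modulus s r) => x.
by rewrite (real_scalar_nonneg s (ltW r0)); exact: Hr.
Qed.

Lemma has_sup_dual_image (phi : V') : has_sup (dual_image phi).
Proof.
split; first by exists (modulus s (phi 0)), 0 => //=; rewrite normr0.
have [C HC] := dual_bounded phi; exists (`|C|) => _ [x /= x1 <-].
rewrite -(ler_real_scalar s) modulusK (le_trans (HC x))//.
rewrite (@le_trans _ _ (real_scalar s `|C| * `|x|))//.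
  by rewrite ler_wpM2r// ler_real_scalar ler_norm.
by rewrite ler_piMr// -(real_scalar0 s) ler_real_scalar.
Qed.

Lemma dual_norm_ge0 (phi : V') : 0 <= dual_norm phi.
Proof.
rewrite /dual_norm -(real_scalar0 s) ler_real_scalar.
apply: (@le_trans _ _ (modulus s (phi 0))); first exact: modulus_ge0.
apply: ub_le_sup; first by case: (has_sup_dual_image phi).
by exists 0 => //=; rewrite normr0.
Qed.

Lemma dual_normP (phi : V') (x : V) : `|phi x| <= dual_norm phi * `|x|.
Proof.
have [->|x0] := eqVneq x 0; first by rewrite linear0 !normr0 mulr0.
have nx : 0 < `|x| by rewrite normr_gt0.
rewrite -ler_pdivrMr// mulrC.
have -> : `|x|^-1 * `|phi x| = real_scalar s (modulus s (phi (`|x|^-1 *: x))).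
  by rewrite modulusK linearZ/= normrM gtr0_norm// invr_gt0.
rewrite ler_real_scalar; apply: ub_le_sup.
  by case: (has_sup_dual_image phi).
exists (`|x|^-1 *: x) => //=.
by rewrite normrZ gtr0_norm ?invr_gt0// mulVf ?gt_eqF.
Qed.

Lemma dual_norm_le (phi : V') (C : R) :
  0 <= C -> (forall x, `|phi x| <= real_scalar s C * `|x|) ->
  dual_norm phi <= real_scalar s C.
Proof.
move=> C0 H; rewrite ler_real_scalar; apply: ge_sup.
  by case: (has_sup_dual_image phi).
move=> _ [x /= x1 <-]; rewrite -(ler_real_scalar s) modulusK (le_trans (H x))//.
by rewrite ler_piMr// -(real_scalar0 s) ler_real_scalar.
Qed.

Lemma dual_normD (phi psi : V') :
  dual_norm (phi + psi) <= dual_norm phi + dual_norm psi.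
Proof.
have e0 (f : V') : 0 <= sup (dual_image f).
  by rewrite -(ler_real_scalar s) real_scalar0 dual_norm_ge0.
rewrite -real_scalarD; apply: dual_norm_le; first by rewrite addr_ge0.
move=> x; rewrite (le_trans (ler_normD _ _))// real_scalarD mulrDl.
by rewrite lerD// dual_normP.
Qed.

Lemma dual_normZ (a : K) (phi : V') : dual_norm (a *: phi) = `|a| * dual_norm phi.
Proof.
have le (b : K) (f : V') : dual_norm (b *: f) <= `|b| * dual_norm f.
  rewrite -(modulusK s b) -real_scalarM; apply: dual_norm_le.
    rewrite mulr_ge0 ?modulus_ge0//.
    by rewrite -(ler_real_scalar s) real_scalar0 dual_norm_ge0.
  move=> x; rewrite real_scalarM modulusK -mulrA.
  by rewrite [X in `|X|]/(b * f x) normrM ler_wpM2l// dual_normP.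
apply/eqP; rewrite eq_le le/=.
have [->|a0] := eqVneq a 0; first by rewrite normr0 mul0r dual_norm_ge0.
rewrite -ler_pdivlMl ?normr_gt0// -normfV.
by have := le a^-1 (a *: phi); rewrite scalerA mulVf// scale1r.
Qed.

Lemma dual_norm0_eq0 (phi : V') : dual_norm phi = 0 -> phi = 0.
Proof.
move=> p0; apply/val_inj/funext => x /=; apply/eqP.
by rewrite -normr_le0 (le_trans (dual_normP phi x))// p0 mul0r.
Qed.

HB.instance Definition _ :=
  Lmodule_isNormed.Build K V' dual_normD dual_normZ dual_norm0_eq0.

Lemma dual_normE (phi : V') : `|phi| = dual_norm phi.
Proof. by []. Qed.

End dual.

Section weak.
Context {R : realType} {K : numFieldType} (s : scalar_field R K).
Context (V : normedModType K).

Definition reflexive_space :=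
  forall Phi : dual s (dual s V), exists x : V,
    forall phi : dual s V, Phi phi = phi x.

Definition weak_cvg (u_ : nat -> V) (u : V) :=
  forall phi : dual s V, phi (u_ n) @[n --> \oo] --> phi u.

Definition weak_space : Type :=
  sup_topology
    (fun phi : dual s V => Topological.class (initial_topology (phi : V -> K^o))).

HB.instance Definition _ := Topological.on weak_space.

Lemma weak_cvgE (u_ : nat -> V) (u : V) :
  weak_cvg u_ u <-> (u_ : nat -> weak_space) @ \oo --> (u : weak_space).
Proof.
split=> [cu|/cvg_sup cu phi].
  apply/cvg_sup => phi A [_ [[B oB <-] Bu BA]].
  by apply: (filterS BA); apply: (cu phi); exact: open_nbhs_nbhs.
by move=> A /(@initial_continuous V K^o phi u); exact: (cu phi).
Qed.

End weak.

Notation rdual := (dual (RealScalars _)).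
Notation "u_ ~~> u" := (weak_cvg (RealScalars _) u_ u) (at level 70).

Section mixed_problem.
Context {R : realType}.

Record mixed_data (X Y Z : normedModType R) := MixedData {
  opA : X -> rdual X ;
  formb : X -> Y -> R ;
  formJ : X -> X -> R ;
  rhs : rdual Z ;
  multipliers : set Y }.

Context {X Y Z : normedModType R}.

Definition mixed_solution (pi : X -> Z) (D : mixed_data X Y Z) (u : X) (l : Y) :=
  [/\ multipliers D l,
      forall v : X, opA D u (v - u) + formb D (v - u) l + formJ D u (v - u)
        >= rhs D (pi (v - u))
    & forall mu : Y, multipliers D mu -> formb D u (mu - l) <= 0].

Record admissible (D : mixed_data X Y Z) (h : X -> R) (r alpha c M q m : R) :
    Prop := Admissible {
  h_exponent : 1 < r ;
  h_homogeneous : forall (t : R) (w : X), 0 < t -> h (t *: w) = t `^ r * h w ;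
  h_monotone : forall u v : X, h (v - u) <= (opA D v - opA D u) (v - u) ;
  h_limsup : forall (w_ : nat -> X) (w : X), w_ ~~> w ->
    ((h w)%:E <= limn_esup (fun k => (h (w_ k))%:E))%E ;
  A_continuous : continuous (opA D) ;
  A_coercive : forall C : R, exists rho : R, forall u : X,
    rho < `|u| -> C < opA D u u / `|u| ;
  b_linearl : forall mu : Y, linear (formb D ^~ mu : X -> R^o) ;
  b_linearr : forall v : X, linear (formb D v : Y -> R^o) ;
  b_weakl : forall (w_ : nat -> X) (w : X), w_ ~~> w ->
    forall mu : Y, formb D (w_ k) mu @[k --> \oo] --> formb D w mu ;
  b_weakr : forall (mu_ : nat -> Y) (mu : Y), mu_ ~~> mu ->
    forall v : X, formb D v (mu_ k) @[k --> \oo] --> formb D v mu ;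
  alpha_gt0 : 0 < alpha ;
  b_inf_sup : (alpha%:E <= ereal_inf
    [set ereal_sup [set (formb D v mu / (`|v| * `|mu|))%:E
                   | v in [set v : X | v != 0%R]]
    | mu in [set mu : Y | mu != 0%R]])%E ;
  J_homogeneous : forall (u v : X) (t : R), 0 < t ->
    formJ D u (t *: v) = t * formJ D u v ;
  J_subadditive : forall u v1 v2 : X,
    formJ D u (v1 + v2) <= formJ D u v1 + formJ D u v2 ;
  c_gt0 : 0 < c ;
  J_bounded : forall u v : X, `|formJ D u v| <= c * `|v| ;
  J_limsup : forall (w_ v_ : nat -> X) (w v : X), w_ ~~> w -> v_ ~~> v ->
    (limn_esup (fun k => (formJ D (w_ k) (v_ k))%:E) <= (formJ D w v)%:E)%E ;
  multipliers_closed : closed (multipliers D) ;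
  multipliers_convex : convex_set (multipliers D) ;
  multipliers_bounded : bounded_set (multipliers D) ;
  multipliers0 : multipliers D 0 ;
  M_gt0 : 0 < M ;
  q_ge2 : 2 <= q ;
  h_lower_bound : forall v : X, M * `|v| `^ q <= h v ;
  m_ge0 : 0 <= m ;
  J_relaxed_monotone : forall w1 w2 : X,
    formJ D w1 (w2 - w1) + formJ D w2 (w1 - w2) <= m * `|w1 - w2| `^ q ;
  m_lt_M : m < M ;
  J_opp : forall u v : X, formJ D u v + formJ D u (- v) <= 0 ;
  A_locally_lipschitz : forall S : set X, S !=set0 -> bounded_set S ->
    exists2 L : R, 0 < L &
      forall u v : X, S u -> S v -> `|opA D u - opA D v| <= L * `|u - v| }.

Definition mosco_cvg (L_ : nat -> set Y) (L : set Y) :=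
  (forall mu : Y, L mu -> exists2 mu_ : nat -> Y,
     forall n, L_ n (mu_ n) & mu_ n @[n --> \oo] --> mu) /\
  (forall (mu_ : nat -> Y) (mu : Y),
     (forall n, L_ n (mu_ n)) -> mu_ ~~> mu -> L mu).

End mixed_problem.

(* Main.v *)
Require Import Defs.
From HB Require Import structures.
From mathcomp Require Import all_boot all_order all_algebra.
From mathcomp Require Import complex lra ring.
From mathcomp Require Import all_classical all_reals all_analysis.

(** Along a minimizing sequence [p_n], which is bounded by (A) or (B), pass to a
    subsequence with [p_n] weakly convergent to [p] in [U]. The solutions
    [(u_n, lam_n)] are bounded, hence converge weakly along a further
    subsequence to some [(u0, lam0)]. Testing the n-th inequality with [u0] and
    comparing [A_{p_n}] with [A_p] by (a) gives
    [M_p |u_n - u0|^q_p <= (A_p u_n - A_p u0, u_n - u0) -> 0], so [u_n]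
    converges strongly; then one can pass to the limit in the mixed problem,
    uniqueness identifies [(u0, lam0)] with [(u_p, lam_p)], and the lower
    semicontinuity of [L] shows that [p] is a minimizer.

    Weak sequential compactness of bounded sequences in a reflexive space:
    along an ultrafilter the values [phi (x_n)] converge to a bounded functional
    on the dual, so a weak limit [x] exists by reflexivity. By Hahn-Banach,
    countably many functionals, norming the rational combinations of the [x_n],
    separate all such limits; a subsequence converging to [x] on these
    functionals thus has [x] as its weak limit along every ultrafilter. *)

Set Implicit Arguments.
Unset Strict Implicit.
Unset Printing Implicit Defensive.

Import Order.TTheory GRing.Theory Num.Theory.
Import numFieldNormedType.Exports.

Local Open Scope classical_set_scope.
Local Open Scope ring_scope.

(** * The Hahn-Banach theorem *)

Section hahn_banach.
Context {R : realType} {V : lmodType R}.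
Implicit Types (p q : V -> R) (x y : V).

Definition sublinear p :=
  (forall x y, p (x + y) <= p x + p y) /\
  (forall t x, 0 <= t -> p (t *: x) <= t * p x).

Lemma sublinear0 p : sublinear p -> p 0 = 0.
Proof.
move=> [pD pZ]; apply/eqP; rewrite eq_le.
have := pZ 0 0 (lexx _); rewrite scale0r mul0r => ->/=.
by have := pD 0 0; rewrite addr0 -[leLHS]addr0 lerD2l.
Qed.

Lemma sublinearZ p t x : sublinear p -> 0 <= t -> p (t *: x) = t * p x.
Proof.
move=> sp; have [_ pZ] := sp; rewrite le_eqVlt => /orP[/eqP <-|t0].
  by rewrite scale0r mul0r sublinear0.
apply/eqP; rewrite eq_le (pZ _ _ (ltW t0))/= -ler_pdivlMl//.
have := pZ t^-1 (t *: x); rewrite invr_ge0 => /(_ (ltW t0)).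
by rewrite scalerA mulVf ?scale1r// gt_eqF.
Qed.

Lemma sublinear_geN p x : sublinear p -> - p (- x) <= p x.
Proof.
move=> sp; have [pD _] := sp.
by have := pD x (- x); rewrite subrr sublinear0// -lerBlDr sub0r.
Qed.

(* The infimum over [t >= 0] of [p (x + t y) - t p y] is sublinear, below [p], and
   [<= - p y] at [- y]; a minimal sublinear functional equals all its tilts,
   which makes it additive. *)
Definition tilt p y x :=
  inf [set p (x + t *: y) - t * p y | t in [set t | 0 <= t]].

Lemma tilt_has_lbound p y x : sublinear p ->
  has_lbound [set p (x + t *: y) - t * p y | t in [set t | 0 <= t]].
Proof.
move=> sp; have [pD pZ] := sp; exists (- p (- x)) => _ [t /= t0 <-].
rewrite -(sublinearZ y sp t0).
have := pD (x + t *: y) (- x); rewrite addrAC subrr add0r; lra.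
Qed.

Lemma tilt_le_at p y x t : sublinear p -> 0 <= t ->
  tilt p y x <= p (x + t *: y) - t * p y.
Proof. by move=> sp t0; apply: ge_inf; [exact: tilt_has_lbound|exists t]. Qed.

Lemma le_tilt p y x z :
  (forall t, 0 <= t -> z <= p (x + t *: y) - t * p y) -> z <= tilt p y x.
Proof.
move=> H; apply: lb_le_inf; first by exists (p (x + 0 *: y) - 0 * p y), 0 => /=.
by move=> _ [t /= t0 <-]; exact: H.
Qed.

Lemma tilt_le p y x : sublinear p -> tilt p y x <= p x.
Proof.
move=> sp; have := tilt_le_at y x sp (lexx 0).
by rewrite scale0r mul0r addr0 subr0.
Qed.

(** Parameters [s] for [x1] and [t] for [x2] yield the parameter [s + t] for [x1 + x2]; scaling the
    vector by [t > 0] scales the parameter by [t]. *)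
Lemma tilt_sublinear p y : sublinear p -> sublinear (tilt p y).
Proof.
move=> sp; have [pD pZ] := sp; split=> [x1 x2|t x].
  rewrite -lerBlDr; apply: le_tilt => s s0.
  rewrite lerBlDr -lerBlDl; apply: le_tilt => t t0.
  rewrite lerBlDl (le_trans (tilt_le_at y (x1 + x2) sp (addr_ge0 s0 t0)))//.
  have := pD (x1 + s *: y) (x2 + t *: y).
  rewrite addrACA -scalerDl; lra.
rewrite le_eqVlt => /orP[/eqP <-|t0].
  by rewrite scale0r mul0r (le_trans (tilt_le y 0 sp))// sublinear0.
rewrite -ler_pdivrMl//; apply: le_tilt => r r0; rewrite ler_pdivrMl//.
rewrite (le_trans (tilt_le_at y (t *: x) sp (mulr_ge0 (ltW t0) r0)))//.
by rewrite mulrBr mulrA lerB// -scalerA -scalerDr (pZ _ _ (ltW t0)).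
Qed.

Lemma minimal_sublinear_scalar g : sublinear g ->
  (forall q, sublinear q -> (forall x, q x <= g x) -> forall x, g x <= q x) ->
  scalar g.
Proof.
move=> sg gmin; have [gD gZ] := sg.
have gA x y : g (x + y) = g x + g y.
  apply/eqP; rewrite eq_le gD/=.
  (* Minimality gives [g x <= tilt g y x], and the parameter 1 bounds this tilt by
     [g (x + y) - g y]. *)
  have := gmin _ (tilt_sublinear y sg) (fun z => tilt_le y z sg) x.
  have := tilt_le_at y x sg ler01; rewrite scale1r mul1r; lra.
have gN x : g (- x) = - g x.
  by apply/eqP; rewrite -addr_eq0 -gA addNr sublinear0.
move=> t x y; rewrite gA; congr (_ + _).
have [t0|t0] := leP 0 t; first exact: sublinearZ.
rewrite -[t in LHS]opprK scaleNr gN sublinearZ//; last by rewrite oppr_ge0 ltW.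
by rewrite mulNr opprK.
Qed.

(** Zorn's lemma for the reversed pointwise order; a nonempty chain is bounded by its pointwise
    infimum. *)
Lemma exists_minimal_sublinear p : sublinear p ->
  exists g, [/\ sublinear g, forall x, g x <= p x &
  forall q, sublinear q -> (forall x, q x <= g x) -> forall x, g x <= q x].
Proof.
move=> sp.
pose T := {q | sublinear q /\ forall x, q x <= p x}.
pose rel_T (q1 q2 : T) := `[< forall x, sval q2 x <= sval q1 x >].
pose p0 : T := exist _ p (conj sp (fun x => lexx _)).
have [| | |[g [sg gp]] gmin] := @ZL_preorder T p0 rel_T.
- by move=> q; apply/asboolP.
- move=> q1 q2 q3 /asboolP q12 /asboolP q23; apply/asboolP => x.
  exact: le_trans (q23 x) (q12 x).
- move=> A Atot; have [[q0 Aq0]|A0] := pselect (A !=set0); last first.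
    by exists p0 => q Aq; case: A0; exists q.
  pose v x := [set sval k x | k in A].
  (* The infimum is finite because [q x >= - q (- x) >= - p (- x)] for every sublinear [q <= p]. *)
  have ilb x : has_lbound (v x).
    exists (- p (- x)) => _ [[q [sq qp]] /= _ <-].
    by rewrite (le_trans _ (sublinear_geN x sq))// lerN2.
  have ile x (q : T) : A q -> inf (v x) <= sval q x.
    by move=> Aq; apply: ge_inf => //; exists q.
  have ileq x z : (forall q : T, A q -> z <= sval q x) -> z <= inf (v x).
    move=> H; apply: lb_le_inf; first by exists (sval q0 x), q0.
    by move=> _ [q Aq <-]; exact: H.
  have sv : sublinear (fun x => inf (v x)).
    split=> [x y|t x].
      rewrite -lerBlDr; apply/ileq => q1 Aq1; rewrite lerBlDr -lerBlDl.
      apply/ileq => q2 Aq2; rewrite lerBlDl.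
      (* The smaller of the two chain members is below both, so its own subadditivity suffices. *)
      have [/asboolP q12|/asboolP q21] := Atot _ _ Aq1 Aq2.
        rewrite (le_trans (ile _ _ Aq2))//.
        by rewrite (le_trans ((svalP q2).1.1 x y))// lerD.
      rewrite (le_trans (ile _ _ Aq1))//.
      by rewrite (le_trans ((svalP q1).1.1 x y))// lerD.
    rewrite le_eqVlt => /orP[/eqP <-|t0].
      rewrite scale0r mul0r (le_trans (ile _ _ Aq0))//.
      by rewrite (sublinear0 (svalP q0).1).
    rewrite -ler_pdivrMl//; apply/ileq => q Aq; rewrite ler_pdivrMl//.
    by rewrite (le_trans (ile _ _ Aq))// (svalP q).1.2// ltW.
  have vp x : inf (v x) <= p x.
    by rewrite (le_trans (ile _ _ Aq0))// (svalP q0).2.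
  exists (exist _ (fun x => inf (v x)) (conj sv vp)) => q Aq.
  by apply/asboolP => x /=; exact: ile.
exists g; split => // q sq qg x.
have qp z : q z <= p z by exact: le_trans (qg z) (gp z).
by have /asboolP/(_ x) := gmin (exist _ q (conj sq qp)) (asboolT qg).
Qed.

(** Minimizing below [tilt p y] instead of [p] forces [g (- y) <= - p y], that is [p y <= g y]. *)
Theorem hahn_banach p y : sublinear p ->
  exists g : V -> R, [/\ scalar g, forall x, g x <= p x & g y = p y].
Proof.
move=> sp.
have [g [sg gt gmin]] := exists_minimal_sublinear (tilt_sublinear y sp).
have gl := minimal_sublinear_scalar sg gmin.
have gp x : g x <= p x by rewrite (le_trans (gt x))// tilt_le.
exists g; split => //; apply/eqP; rewrite eq_le gp/=.
have := tilt_le_at y (- y) sp ler01; rewrite scale1r addNr sublinear0// mul1r.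
move=> /(le_trans (gt _)).
have := gl (-1) y 0; rewrite scaleN1r addr0 (sublinear0 sg) addr0 mulN1r => ->.
by rewrite sub0r lerN2.
Qed.

End hahn_banach.

(** * Weak sequential compactness in reflexive spaces *)

(** If [P] failed to hold eventually, [F] restricted to the complement of [P] would be proper and
    would extend to an ultrafilter avoiding [P]. *)
Lemma near_ultra {T : Type} (F : set_system T) (P : T -> Prop) :
  ProperFilter F ->
  (forall G, UltraFilter G -> F `<=` G -> \forall t \near G, P t) ->
  \forall t \near F, P t.
Proof.
move=> FF H; apply: contrapT => nP.
have properF : ProperFilter (within (~` P) F).
  apply: Build_ProperFilter_ex.
  move=> B FB; apply: contrapT => nB; apply: nP.
  have {}FB : F [set t | ~ P t -> B t] := FB.
  apply: filterS FB => t /= tB.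
  by apply: contrapT => nPt; apply: nB; exists t; exact: tB.
have [G [GU FG]] := ultraFilterLemma properF.
have GP : G P by apply: H => // B FB; apply: FG; apply: filterS FB => t Bt _.
have GnP : G (~` P) by apply: FG; exact: withinT.
have /filter_ex[t []//] : G (P `&` ~` P) by exact: filterI.
Qed.

(** A cluster point of an ultrafilter is a limit, since each set or its complement belongs to the
    ultrafilter. *)
Lemma ultra_cvg_compact {T : Type} {U : topologicalType} (G : set_system T)
    (f : T -> U) (A : set U) :
  UltraFilter G -> compact A -> (forall t, A (f t)) ->
  exists l : U, f @ G --> l.
Proof.
move=> GU Aco fA.
have fGA : (f @ G) A by exact: (@filterE _ G).
have [l [_ cl]] := Aco _ (fmap_proper_filter f _) fGA.
exists l => B lB; have [//|GnB] := in_ultra_setVsetC (f @^-1` B) GU.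
by have [u [nBu /nBu]] := cl (~` B) B GnB lB.
Qed.

(** * Uniform treatment of real and complex scalars *)

Section scalars.
Context {R : realType} {K : numFieldType} (s : scalar_field R K).

Definition real_part : K -> R :=
  match s in scalar_field _ K' return K' -> R with
  | RealScalars => fun x => x
  | ComplexScalars => fun z => complex.Re z
  end.

(** The norm takes values in [K]; this real copy lets estimates be made in [R] for both kinds of
    scalars. *)
Definition rnorm (V : normedModType K) (x : V) : R := modulus s `|x|.

Lemma real_scalar_rnorm (V : normedModType K) (x : V) :
  real_scalar s (rnorm x) = `|x|.
Proof. by rewrite real_scalar_nonneg. Qed.

Lemma rnorm_ge0 (V : normedModType K) (x : V) : 0 <= rnorm x.
Proof. exact: modulus_ge0. Qed.

Lemma ltr_real_scalar (a b : R) :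
  (real_scalar s a < real_scalar s b) = (a < b).
Proof. by case: s => //=; rewrite ltcR. Qed.

Lemma real_scalar_natr (n : nat) : real_scalar s n%:R = n%:R.
Proof. by case: s => //=; rewrite rmorph_nat. Qed.

Lemma modulus_real_scalar (a : R) : modulus s (real_scalar s a) = `|a|.
Proof. by case: s => //=; rewrite expr0n addr0 sqrtr_sqr. Qed.

Lemma cvg_modulusP (V : normedModType K) (T : Type) (F : set_system T)
    (f : T -> V) (l : V) : Filter F ->
  (f @ F --> l) <->
  forall e : R, 0 < e -> \forall t \near F, rnorm (l - f t) < e.
Proof.
move=> FF; split=> [/cvgrPdist_lt fl e e0|H].
  have e0' : 0 < real_scalar s e by rewrite -(real_scalar0 s) ltr_real_scalar.
  apply: filterS (fl _ e0') => t.
  by rewrite -real_scalar_rnorm ltr_real_scalar.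
apply/cvgrPdist_lt => e e0; have := H (modulus s e).
rewrite -ltr_real_scalar real_scalar0 real_scalar_nonneg ?ltW// => /(_ e0).
apply: filterS => t.
by rewrite -ltr_real_scalar real_scalar_rnorm real_scalar_nonneg ?ltW.
Qed.

End scalars.

Lemma normcR {R : realType} (x : R) : `|x%:C%C| = `|x|%:C%C.
Proof. by rewrite normc_def/= expr0n addr0 sqrtr_sqr. Qed.

Lemma normci {R : realType} : `|'i%C| = 1 :> R[i]%C.
Proof. by rewrite normc_def/= expr0n expr1n add0r sqrtr1. Qed.

(** Real values lie in a compact segment; complex values are handled through their real and
    imaginary parts. *)
Lemma ultra_bounded_cvg {R : realType} (K : numFieldType) (s : scalar_field R K)
    (T : Type) (G : set_system T) (f : T -> K) (B : R) :
  UltraFilter G -> (forall t, `|f t| <= real_scalar s B) ->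
  exists l : K^o, (f : T -> K^o) @ G --> l.
Proof.
move=> GU; have realcase (g : T -> R) : (forall t, `|g t| <= B) ->
    exists l : R, g @ G --> l.
  move=> gB; apply: (ultra_cvg_compact GU (@segment_compact R (- B) B)) => t.
  by rewrite /= in_itv/= -ler_norml.
case: K / s f => /= f fB; first exact: realcase.
(* Multiplication by [i] turns the imaginary part into a real part, up to sign. *)
have Im_le (z : R[i]) : (`|complex.Im z|%:C <= `|z|)%C.
  have := normc_ge_Re (z * 'i%C); rewrite ReiNIm normrN normrM.
  by rewrite normci mulr1.
have [|a fa] := realcase (fun t => complex.Re (f t)).
  by move=> t; rewrite -lecR (le_trans (normc_ge_Re _)).
have [|b fb] := realcase (fun t => complex.Im (f t)).
  by move=> t; rewrite -lecR (le_trans (Im_le _)).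
exists (a +i* b)%C.
apply/(@cvg_modulusP _ _ (ComplexScalars R) (R[i]^o)%C) => e e0.
have e20 : 0 < e / 2 by rewrite divr_gt0.
move/cvgrPdist_lt : fa => /(_ _ e20) fa.
move/cvgrPdist_lt : fb => /(_ _ e20) fb.
apply: filterS2 fa fb => t at_ bt.
rewrite /rnorm -ltcR -[X in X < _]/(real_scalar (ComplexScalars R) _).
rewrite real_scalar_nonneg//.
rewrite [X in `|X|]complexE (le_lt_trans (ler_normD _ _))//.
rewrite normrM normci mul1r !normcR -rmorphD ltcR [e]splitr.
by move: at_ bt; case: (f t) => c d /=; exact: ltrD.
Qed.

(** * Bounded functionals, and real versus complex linearity *)

Section dual_of_bounded.
Context {R : realType} {K : numFieldType} (s : scalar_field R K).
Context {V : normedModType K}.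

Lemma dual_of_bounded (f : V -> K^o) (C : R) :
  linear f -> (forall x, `|f x| <= real_scalar s C * `|x|) ->
  exists phi : dual s V, forall x, phi x = f x.
Proof.
move=> fl fC.
pose F : {linear V -> K^o} := HB.pack f (GRing.isLinear.Build _ _ _ _ f fl).
have Fc : continuous F.
  apply/linear_bounded_continuous/linear_boundedP.
  exists (real_scalar s `|C|); split.
    by rewrite ger0_real// -(real_scalar0 s) ler_real_scalar.
  move=> r Cr x; rewrite (le_trans (fC x))// ler_wpM2r//.
  by rewrite (le_trans _ (ltW Cr))// ler_real_scalar ler_norm.
have fP : f \in is_functional V by apply/asboolP; split.
by exists (Dual s fP).
Qed.

End dual_of_bounded.

(** An alias of [V], so that the real module structure used for Hahn-Banach does not clash with the
    [K]-structure. *)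
Definition restrict_scalars {R : realType} {K : numFieldType}
  (s : scalar_field R K) (V : lmodType K) : Type := V.

Section restrict_scalars.
Context {R : realType} {K : numFieldType} (s : scalar_field R K).
Context {V : lmodType K}.
Local Notation VR := (restrict_scalars s V).

HB.instance Definition _ := GRing.Zmodule.on VR.

Let scale (t : R) (x : VR) : VR := real_scalar s t *: (x : V).

Let scaleA a b (x : VR) : scale a (scale b x) = scale (a * b) x.
Proof. by rewrite /scale scalerA real_scalarM. Qed.

Let scale1 : left_id 1 scale.
Proof. by move=> x; rewrite /scale (real_scalar_natr s 1) scale1r. Qed.

Let scaleDr : right_distributive scale +%R.
Proof. by move=> a x y; rewrite /scale scalerDr. Qed.

Let scaleDl (x : VR) : {morph scale^~ x : a b / a + b}.
Proof. by move=> a b; rewrite /scale real_scalarD scalerDl. Qed.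

HB.instance Definition _ := GRing.Zmodule_isLmodule.Build R VR
  scaleA scale1 scaleDr scaleDl.

End restrict_scalars.

Section real_functionals.
Context {R : realType}.

(** In the complex case a real-linear [g] is the real part of the complex-linear functional
    [g x - i g (i x)]. *)
Lemma dual_of_real_functional (K : numFieldType) (s : scalar_field R K)
    (V : normedModType K) (g : restrict_scalars s V -> R) :
  scalar g -> (forall x, `|g x| <= rnorm s (x : V)) ->
  exists phi : dual s V, forall x, real_part s (phi x) = g x.
Proof.
case: K / s V g => V g gl gb.
  have [||phi phiE] := @dual_of_bounded R R (RealScalars R) V g 1.
  - exact: gl.
  - by move=> x; rewrite /= mul1r (le_trans (gb x))// /rnorm/= normr_id.
  by exists phi => x; rewrite /= phiE.
pose VR := restrict_scalars (ComplexScalars R) V.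
pose f (x : V) : R[i]%C := (g x -i* g ('i%C *: x))%C.
have gD x y : g (x + y) = g x + g y.
  by have := gl 1 x y; rewrite scale1r mul1r.
have gZ t x : g ((t%:C)%C *: (x : V)) = t * g x.
  have g0 : g 0 = 0.
    by have := gD 0 0; rewrite addr0 => /eqP; rewrite -subr_eq subrr => /eqP.
  by have := gl t x 0; rewrite !addr0 g0 addr0.
have gi x : g ('i%C *: ('i%C *: (x : V)) : V) = - g x.
  rewrite scalerA -expr2 sqr_i.
  by have := gZ (-1) x; rewrite rmorphN1 mulN1r.
have fl : linear (f : V -> R[i]^o%C).
  move=> [a b] x y; apply/eqP; rewrite eq_complex; apply/andP.
  have cE : (a +i* b)%C = a%:C%C + b%:C%C * 'i%C.
    by apply/eqP; rewrite eq_complex/=; apply/andP; split; apply/eqP; ring.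
  rewrite /f /= cE scalerDl -scalerA !scalerDr !gD !gZ.
  have gCi (t : R) (z : V) : g ('i%C *: (t%:C%C *: z)) = t * g ('i%C *: z).
    by rewrite scalerA mulrC -scalerA gZ.
  by split; apply/eqP; rewrite ?gCi ?gi; ring.
(* The factor 2 adds the bounds for the real and the imaginary part; any finite constant gives
   continuity. *)
have fb x : `|f x| <= real_scalar (ComplexScalars R) 2 * `|x|.
  rewrite -(real_scalar_rnorm (ComplexScalars R)) -real_scalarM.
  rewrite [f x]complexE (le_trans (ler_normD _ _))//.
  rewrite normrM normci mul1r !normcR.
  rewrite -rmorphD lecR mulr_natl mulr2n lerD//= normrN (le_trans (gb _))//.
  by rewrite /rnorm normrZ normci mul1r.
have [phi phiE] := dual_of_bounded fl fb.
by exists phi => x; rewrite phiE.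
Qed.

End real_functionals.

Section real_functionals.
Context {R : realType} {K : numFieldType} (s : scalar_field R K).
Context {V : normedModType K}.
Local Notation VR := (restrict_scalars s V).
Local Notation nrm := (fun x : VR => rnorm s (x : V)).

Lemma rnormD (x y : V) : rnorm s (x + y) <= rnorm s x + rnorm s y.
Proof.
by rewrite -(ler_real_scalar s) real_scalarD !real_scalar_rnorm ler_normD.
Qed.

Lemma rnorm0 : rnorm s (0 : V) = 0.
Proof.
by apply: (@real_scalar_inj _ _ s); rewrite real_scalar_rnorm normr0 real_scalar0.
Qed.

Lemma rnormN (x : V) : rnorm s (- x) = rnorm s x.
Proof. by rewrite /rnorm normrN. Qed.

Lemma rnormB (x y : V) : rnorm s (x - y) = rnorm s (y - x).
Proof. by rewrite -rnormN opprB. Qed.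

Lemma rnormZ (t : R) (x : VR) : nrm (t *: x) = `|t| * nrm x.
Proof.
apply: (@real_scalar_inj _ _ s); rewrite real_scalarM !real_scalar_rnorm normrZ.
by rewrite -(modulusK s) modulus_real_scalar.
Qed.

Lemma rnorm_eq0 (x : V) : rnorm s x <= 0 -> x = 0.
Proof.
rewrite -(ler_real_scalar s) real_scalar_rnorm real_scalar0 normr_le0.
by move/eqP.
Qed.

Lemma rnorm_sublinear : sublinear nrm.
Proof.
split=> [x y|t x t0]; first exact: rnormD.
by rewrite rnormZ ger0_norm.
Qed.

Lemma scalarN (g : VR -> R) : scalar g -> forall x, g (- x) = - g x.
Proof.
move=> gl x; have g0 : g 0 = 0.
  have := gl 1 0 0; rewrite scaler0 mul1r addr0 => /eqP.
  by rewrite -subr_eq subrr => /eqP.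
by have := gl (-1) x 0; rewrite scaleN1r !addr0 g0 addr0 mulN1r.
Qed.

Lemma dominated_bounded (g : VR -> R) : scalar g -> (forall x, g x <= nrm x) ->
  forall x, `|g x| <= nrm x.
Proof.
move=> gl gp x; rewrite ler_norml gp andbT lerNl -scalarN//.
by rewrite (le_trans (gp _))// rnormN.
Qed.

Lemma cvg_real_part (T : Type) (F : set_system T) (f : T -> K^o) (l : K^o) :
  Filter F -> f @ F --> l -> real_part s (f t) @[t --> F] --> real_part s l.
Proof.
move=> FF /(cvg_modulusP s) fl; apply/cvgrPdist_lt => e e0.
apply: filterS (fl _ e0) => t; apply: le_lt_trans.
case: K / s f l {fl} => f l; first by rewrite /rnorm/= normr_id.
rewrite -lecR -[leRHS]/(real_scalar (ComplexScalars R) _) real_scalar_rnorm.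
rewrite /=; apply: le_trans (normc_ge_Re _).
by case: l => a b; case: (f t).
Qed.

(** Serves as a Hahn-Banach majorant: a functional below [dist Y] is nonpositive on [Y]. *)
Definition dist (Y : set VR) (z : VR) := inf [set nrm (z - y) | y in Y].

Lemma dist_le (Y : set VR) z y : Y y -> dist Y z <= nrm (z - y).
Proof.
move=> Yy; apply: ge_inf; last by exists y.
by exists 0 => _ [w _ <-]; exact: rnorm_ge0.
Qed.

Lemma le_dist (Y : set VR) z c : Y !=set0 ->
  (forall y, Y y -> c <= nrm (z - y)) -> c <= dist Y z.
Proof.
move=> [w Yw] H; apply: lb_le_inf; first by exists (nrm (z - w)), w.
by move=> _ [y Yy <-]; exact: H.
Qed.

(** Since [Y] is stable under rational multiples only, homogeneity for a real factor comes from
    rational approximation. *)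
Lemma dist_sublinear (Y : set VR) : Y !=set0 ->
  (forall x y, Y x -> Y y -> Y (x + y)) ->
  (forall a y, Y y -> Y (ratr a *: y)) -> sublinear (dist Y).
Proof.
move=> Y0 YD YZ; split=> [x y|t x t0].
  rewrite -lerBlDr; apply: le_dist => // x' Yx'; rewrite lerBlDr -lerBlDl.
  apply: le_dist => // y' Yy'; rewrite lerBlDl.
  rewrite (le_trans (dist_le _ (YD _ _ Yx' Yy')))//= opprD addrACA.
  exact: rnormD.
have [->|tn0] := eqVneq t 0.
  rewrite mul0r scale0r; have [y Yy] := Y0.
  rewrite (le_trans (dist_le _ (YZ 0 y Yy)))//=.
  by rewrite rmorph0 scale0r subr0 rnorm0.
have {tn0}t0 : 0 < t by rewrite lt_neqAle eq_sym tn0.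
rewrite -ler_pdivrMl//; apply: le_dist => // y Yy; rewrite ler_pdivrMl//.
apply/ler_addgt0Pr => e e0.
(* Replacing [t] by a nearby rational [a] costs [(a - t) * nrm y], at most [e]; the added 1 avoids
   division by zero. *)
have ny1 : 0 < nrm y + 1 by rewrite ltr_wpDl ?rnorm_ge0.
have [|a] := @rat_in_itvoo R t (t + e / (nrm y + 1)).
  by rewrite ltrDl divr_gt0.
rewrite in_itv/= => /andP[ta ae].
rewrite (le_trans (dist_le _ (YZ a y Yy)))//=.
have -> : t *: x - ratr a *: y = t *: (x - y) + (t - ratr a) *: y.
  by rewrite scalerBr scalerBl addrA subrK.
rewrite (le_trans (rnormD _ _))// !rnormZ gtr0_norm// lerD2l.
rewrite ler0_norm ?opprB; last by rewrite subr_le0 ltW.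
apply: (@le_trans _ _ (e / (nrm y + 1) * (nrm y + 1))).
  rewrite ler_pM ?subr_ge0 ?rnorm_ge0 ?(ltW ta)//.
    by rewrite lerBlDl ltW.
  by rewrite lerDl.
by rewrite divfK ?gt_eqF.
Qed.

End real_functionals.

Section weak_compactness.
Context {R : realType} {K : numFieldType} (s : scalar_field R K).
Context {V : normedModType K}.
Local Notation VR := (restrict_scalars s V).
Hypothesis reflV : reflexive_space s V.

Lemma ultra_weak_limit (T : Type) (G : set_system T) (x_ : T -> V) (B : R) :
  UltraFilter G -> (forall t, `|x_ t| <= real_scalar s B) ->
  exists x : V, forall phi : dual s V, phi (x_ t) @[t --> G] --> phi x.
Proof.
move=> GU xB.
have phiB (phi : dual s V) t : `|phi (x_ t)| <= real_scalar s B * `|phi|.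
  rewrite (le_trans (dual_normP phi (x_ t)))// mulrC ler_wpM2r//.
  exact: dual_norm_ge0.
have /choice[l lP] : forall phi : dual s V,
    exists l : K^o, phi (x_ t) @[t --> G] --> l.
  move=> phi; apply: (@ultra_bounded_cvg _ _ s _ _ _ (B * rnorm s phi)) => t.
  by rewrite real_scalarM real_scalar_rnorm.
have ll : linear l.
  move=> a phi psi.
  have E t : (a *: phi + psi) (x_ t) = a *: phi (x_ t) + psi (x_ t) by [].
  have H : (a *: phi + psi) (x_ t) @[t --> G] --> a *: l phi + l psi.
    under eq_fun do rewrite E.
    by apply: cvgD (lP psi); exact: cvgZl_tmp (lP phi).
  exact: (@cvg_unique K^o (@norm_hausdorff _ _) _ _ _ _ (lP _) H).
have lb (phi : dual s V) : `|l phi| <= real_scalar s B * `|phi|.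
  apply/ler_addgt0Pr => e e0.
  have /cvgrPdist_lt/(_ _ e0)/filter_ex[t lt] := lP phi.
  rewrite -[l phi](subrK (phi (x_ t))) (le_trans (ler_normD _ _))// addrC.
  by rewrite lerD// ltW.
have [Phi PhiE] := dual_of_bounded ll lb.
have [x xP] := reflV Phi.
by exists x => phi; rewrite -xP PhiE; exact: lP.
Qed.

(** Weak limits pass to norm-dominated real functionals, these being real parts of elements of the
    dual. *)
Lemma ultra_weak_limit_real (T : Type) (G : set_system T) (x_ : T -> V) (x : V)
    (g : VR -> R) :
  Filter G -> (forall phi : dual s V, phi (x_ t) @[t --> G] --> phi x) ->
  scalar g -> (forall y, g y <= rnorm s (y : V)) ->
  g (x_ t) @[t --> G] --> g x.
Proof.
move=> GF xP gl gp.
have [phi phiE] := dual_of_real_functional gl (dominated_bounded gl gp).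
rewrite -phiE; under eq_fun do rewrite -phiE.
by apply: cvg_real_part; exact: xP.
Qed.

(** The index map [k] is only asked to dominate the identity, which already transports limits and
    eventual properties. *)
Lemma weak_sequential_compactness (x_ : nat -> V) (B : R) :
  (forall n, `|x_ n| <= real_scalar s B) ->
  exists (k : nat -> nat) (x : V), (forall n, n <= k n)%N /\
    weak_cvg s (x_ \o k) x.
Proof.
move=> xB.
(* Rational combinations are indexed by a countable type, so the functionals norming them can be
   enumerated by [pickle]. *)
pose comb (a : seq (nat * rat)) : VR := \sum_(i <- a) ratr i.2 *: (x_ i.1 : VR).
pose Y := range comb.
have Y0 : Y 0 by exists [::] => //; rewrite /comb big_nil.
have sY : sublinear (dist Y).
  apply: dist_sublinear; first by exists 0.
    move=> _ _ [a _ <-] [b _ <-]; exists (a ++ b) => //.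
    by rewrite /comb big_cat.
  move=> r _ [a _ <-]; exists [seq (i.1, r * i.2) | i <- a] => //.
  rewrite /comb big_map scaler_sumr; apply: eq_bigr => i _ /=.
  by rewrite rmorphM scalerA.
have distY_le z : dist Y z <= rnorm s (z : V).
  by rewrite (le_trans (dist_le _ Y0))//= subr0.
have distx n : dist Y (x_ n) <= 0.
  have Yx : Y (x_ n).
    by exists [:: (n, 1)] => //; rewrite /comb big_seq1 rmorph1 scale1r.
  by rewrite (le_trans (dist_le _ Yx))//= subrr rnorm0.
(* A functional below [dist Y] that attains it at [x] is nonpositive along the sequence, hence at
   its weak limit [x]. *)
have dist_lim (k : nat -> nat) G x : UltraFilter G ->
    (forall phi : dual s V, phi (x_ (k t)) @[t --> G] --> phi x) ->
    dist Y x <= 0.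
  move=> GU xP; have [g [gl gp <-]] := hahn_banach (x : VR) sY.
  apply/ler_addgt0Pr => e e0.
  have gx : g (x_ (k t)) @[t --> G] --> g x.
    apply: (@ultra_weak_limit_real _ _ (x_ \o k)) => // y.
    exact: le_trans (gp y) (distY_le y).
  have /cvgrPdist_lt/(_ _ e0)/filter_ex[t gt] := gx.
  have := le_trans (gp _) (distx (k t)); have := le_lt_trans (ler_norm _) gt.
  lra.
have /choice[g gP] : forall a, exists g : VR -> R,
    [/\ scalar g, forall x, g x <= rnorm s (x : V) &
        g (comb a) = rnorm s (comb a : V)].
  by move=> a; exact: hahn_banach (comb a) (@rnorm_sublinear _ _ s V).
have [G0 [G0U ooG0]] := @ultraFilterLemma nat \oo _.
have [x xP] := ultra_weak_limit G0U xB.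
have gx a : g a (x_ t) @[t --> G0] --> g a x.
  by have [gl gp _] := gP a; exact: ultra_weak_limit_real.
(* The index chosen at stage [n] approximates [x] on all functionals of code below [n], within
   [1 / (n + 1)]. *)
pose near_x n m := (n <= m)%N /\
  forall j : 'I_n, forall a, unpickle j = Some a ->
    `|g a x - g a (x_ m)| < n.+1%:R^-1.
have /choice[k kP] : forall n, exists m, near_x n m.
  move=> n; apply: (@filter_ex _ G0); apply: filterI.
    by apply: ooG0; exists n.
  apply: filter_forall => j; case: unpickle => [a|]; last first.
    by apply: (@filterE _ G0) => m a.
  have /cvgrPdist_lt/(_ n.+1%:R^-1) := gx a.
  rewrite invr_gt0 ltr0n => /(_ isT); apply: filterS => m gm b [<-].
  exact: gm.
have gk a : g a (x_ (k n)) @[n --> \oo] --> g a x.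
  apply/cvgrPdist_lt => e e0.
  near=> n.
  have an : (pickle a < n)%N by near: n; exact: nbhs_infty_gt.
  have [_ /(_ (Ordinal an) a) gan] := kP n.
  apply: lt_trans (gan (pickleK _)) _.
  by near: n; exact: (near_infty_natSinv_lt (PosNum e0)).
have distN z : dist Y (- z) <= dist Y z.
  apply: le_dist => [|_ [a _ <-]]; first by exists 0.
  have Ya : Y (- comb a).
    exists [seq (i.1, - i.2) | i <- a] => //.
    rewrite /comb big_map -sumrN; apply: eq_bigr => i _ /=.
    by rewrite rmorphN scaleNr.
  by rewrite (le_trans (dist_le _ Ya))//= -opprB opprK addrC -rnormN opprK.
exists k, x; split=> [n|phi]; first by have [] := kP n.
(* By [near_ultra] it suffices to identify the weak limit along each ultrafilter finer than
   [\oo]. *)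
move=> A xA.
apply: (@near_ultra _ \oo (fun n => A (phi (x_ (k n))))) => G GU ooG.
have [x' x'P] := ultra_weak_limit GU (fun n => xB (k n)).
suff xx' : x = x' by rewrite xx' in xA; exact: (x'P phi).
have dz : dist Y ((x : VR) - x') <= 0.
  have [dD _] := sY; rewrite (le_trans (dD _ _))// -[leRHS]addr0 lerD//.
    apply: (dist_lim id G0) => //.
  rewrite (le_trans (distN _))//; exact: (dist_lim k G).
apply/eqP; rewrite -subr_eq0; apply/eqP/(@rnorm_eq0 _ _ s).
apply/ler_addgt0Pr => e e0.
have e20 : 0 < e / 2 by rewrite divr_gt0.
have [a za] : exists a, rnorm s (x - x' - comb a) < e / 2.
  apply: contrapT => /forallNP H.
  have : e / 2 <= dist Y ((x : VR) - x').
    apply: le_dist => [|_ [a _ <-]]; first by exists 0.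
    by rewrite leNgt; apply/negP/H.
  by move=> /le_trans/(_ dz); rewrite leNgt e20.
have [gl gp ga] := gP a.
have gxx' : g a x = g a x'.
  apply: (@cvg_unique R (@norm_hausdorff _ _) ((fun n => g a (x_ (k n))) @ G)).
    by move=> C xC; apply: ooG; exact: gk.
  by apply: (@ultra_weak_limit_real _ _ (x_ \o k)).
have gz : g a ((x : VR) - x') = 0.
  have := gl (-1) x' x; rewrite scaleN1r gxx' mulN1r addNr => <-.
  by congr (g a _); exact: addrC.
have : rnorm s (comb a : V) <= rnorm s (x - x' - comb a).
  rewrite -ga rnormB -[leLHS]subr0 -gz -scalarN//.
  have := gl 1 (comb a) (- (x - x')); rewrite scale1r mul1r => <-.
  exact: gp.
have := rnormD s (x - x' - comb a) (comb a); rewrite subrK.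
lra.
Unshelve. all: by end_near. Qed.

End weak_compactness.

(** * Weak convergence *)

Lemma limn_esup_near {R : realType} (x_ : R^nat) (l e : R) :
  (limn_esup (fun n => (x_ n)%:E) <= l%:E)%E -> 0 < e ->
  \forall n \near \oo, x_ n < l + e.
Proof.
move=> xl e0; have : (limn_esup (fun n => (x_ n)%:E) < (l + e)%:E)%E.
  by rewrite (le_lt_trans xl)// lte_fin ltrDl.
move=> /ereal_inf_lt[_ [A ooA <-]] Ale; apply: filterS ooA => n An.
by rewrite -lte_fin (le_lt_trans _ Ale)//; apply: ereal_sup_ubound; exists n.
Qed.

Lemma limn_einf_near {R : realType} (x_ : R^nat) (l e : R) :
  (l%:E <= limn_einf (fun n => (x_ n)%:E))%E -> 0 < e ->
  \forall n \near \oo, l - e < x_ n.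
Proof.
move=> xl e0; have : (limn_esup (fun n => (- x_ n)%:E) <= (- l)%:E)%E.
  rewrite EFinN leeNr; exact: xl.
move=> /limn_esup_near/(_ e0); apply: filterS => n; lra.
Qed.

Lemma cvg_seq_norm_bound {R : realType} {V : normedModType R}
    (x_ : nat -> V) (x : V) : x_ n @[n --> \oo] --> x ->
  exists2 C : R, 0 <= C & forall n, `|x_ n| <= C.
Proof.
move=> xx; have /cvg_seq_bounded/pinfty_ex_gt0[C C0 HC] : cvgn x_.
  by apply/cvg_ex; exists x.
by exists C => [|n]; [exact: ltW|exact: HC].
Qed.

Section weak_convergence.
Context {R : realType} {K : numFieldType} (s : scalar_field R K).
Context {V : normedModType K}.

Lemma cvg_weak_cvg (x_ : nat -> V) (x : V) :
  x_ n @[n --> \oo] --> x -> weak_cvg s x_ x.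
Proof.
by move=> xx phi; apply: (@cvg_comp _ _ _ x_ phi) xx _; exact: dual_continuous.
Qed.

Lemma weak_cvgB (x_ y_ : nat -> V) (x y : V) :
  weak_cvg s x_ x -> weak_cvg s y_ y ->
  weak_cvg s (fun n => x_ n - y_ n) (x - y).
Proof.
move=> xx yy phi; rewrite linearB/=.
by under eq_fun do rewrite linearB/=; apply: cvgB; [exact: xx|exact: yy].
Qed.

Lemma weak_cvg_cst (x : V) : weak_cvg s (fun=> x) x.
Proof. by move=> phi; exact: cvg_cst. Qed.

Lemma weak_cvg_comp (x_ : nat -> V) (x : V) (k : nat -> nat) :
  (forall n, n <= k n)%N -> weak_cvg s x_ x -> weak_cvg s (x_ \o k) x.
Proof.
move=> nk xx phi; apply: cvg_comp (xx phi) => A [N _ NA].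
by exists N => // n /= Nn; apply: NA => /=; exact: leq_trans (nk n).
Qed.

End weak_convergence.

(** * Real duals and convergence of duality pairings *)

Section real_dual.
Context {R : realType} {V : normedModType R}.

Lemma pairing_norm (phi : rdual V) (x : V) : `|phi x| <= `|phi| * `|x|.
Proof. exact: dual_normP. Qed.

(** Evaluation at [x] is a bounded functional on the dual. *)
Lemma weak_cvg_dual_pointwise (f_ : nat -> rdual V) (f : rdual V) :
  f_ ~~> f -> forall x : V, f_ n x @[n --> \oo] --> f x.
Proof.
move=> ff x.
have [||ev evE] := @dual_of_bounded R R (RealScalars R) (rdual V)
    (fun phi => phi x : R^o) `|x|.
- by [].
- by move=> phi; rewrite mulrC; exact: pairing_norm.
by have := ff ev; rewrite evE; under eq_fun do rewrite evE.
Qed.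

End real_dual.

(** The uniform boundedness principle, applied to the pointwise bounded family of the [f_ n] on the
    complete space [V]. *)
Lemma weak_cvg_dual_bounded {R : realType} {V : completeNormedModType R}
    (f_ : nat -> rdual V) (f : rdual V) :
  f_ ~~> f -> exists2 C : R, 0 <= C & forall n, `|f_ n| <= C.
Proof.
move=> ff; pose F := range (fun n => dual_fun (f_ n)).
have F_linear (g : V -> R^o) : F g -> bounded_fun_norm g /\ linear g.
  move=> [n _ <-]; split; last exact: dual_linear.
  move=> r; exists (`|f_ n| * r) => x xr.
  by rewrite (le_trans (pairing_norm _ _))// ler_wpM2l.
have F_pointwise : pointwise_bounded F.
  move=> x; have fx := @weak_cvg_dual_pointwise _ _ f_ f ff x.
  by have [C _ HC] := cvg_seq_norm_bound fx; exists C => _ [n _ <-]; exact: HC.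
have [M HM] := Banach_Steinhauss F_linear F_pointwise 1.
have M0 : 0 <= M.
  by rewrite (le_trans _ (HM (f_ 0%N) _ 0 _)) ?normr0//; exists 0%N.
exists M => // n; apply: ge_sup; first by case: (has_sup_dual_image (f_ n)).
by move=> _ [x /= x1 <-]; apply: HM => //; exists n.
Qed.

Lemma cvg0_norm_le {R : realType} (a_ b_ : R^nat) :
  (forall n, `|a_ n| <= b_ n) -> b_ n @[n --> \oo] --> (0 : R) ->
  a_ n @[n --> \oo] --> (0 : R).
Proof.
move=> ab b0; apply: (@squeeze_cvgr _ _ _ _ (fun n => - b_ n) b_) => //.
  by near=> n; rewrite -ler_norml.
by rewrite -oppr0; exact: cvgN.
Unshelve. all: by end_near. Qed.

Section pairings.
Context {R : realType} {V : normedModType R}.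

Lemma cvg_bounded_pairing (phi_ : nat -> rdual V) (phi : rdual V)
    (x_ : nat -> V) (x : V) (C : R) :
  (forall n, `|phi_ n| <= C) -> phi_ n x @[n --> \oo] --> phi x ->
  x_ n @[n --> \oo] --> x -> phi_ n (x_ n) @[n --> \oo] --> phi x.
Proof.
move=> phiC phix xx.
have -> : (fun n => phi_ n (x_ n)) = (fun n => phi_ n (x_ n - x) + phi_ n x).
  by apply/funext => n; rewrite linearB/= subrK.
rewrite -[phi x]add0r; apply: cvgD => //.
apply: (@cvg0_norm_le _ _ (fun n => C * `|x_ n - x|)) => [n|].
  by rewrite (le_trans (pairing_norm _ _))// ler_wpM2r.
by rewrite -(mulr0 C); apply: cvgMl_tmp; apply/norm_cvg0P/subr_cvg0.
Qed.

Lemma cvg_pairing_weak (phi_ : nat -> rdual V) (phi : rdual V)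
    (x_ : nat -> V) (x : V) (C : R) :
  (forall n, `|x_ n| <= C) -> phi_ n @[n --> \oo] --> phi ->
  x_ ~~> x -> phi_ n (x_ n) @[n --> \oo] --> phi x.
Proof.
move=> xC phiphi xx.
have -> : (fun n => phi_ n (x_ n)) =
    (fun n => (phi_ n - phi) (x_ n) + phi (x_ n)).
  apply/funext => n.
  by rewrite -[RHS]/(phi_ n (x_ n) - phi (x_ n) + phi (x_ n)) subrK.
rewrite -[phi x]add0r; apply: cvgD; last exact: xx.
apply: (@cvg0_norm_le _ _ (fun n => `|phi_ n - phi| * C)) => [n|].
  by rewrite (le_trans (pairing_norm _ _))// ler_wpM2l.
by rewrite -(mul0r C); apply: cvgMr_tmp; apply/norm_cvg0P/subr_cvg0.
Qed.

End pairings.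

Section linear_function.
Context {R : pzRingType} {U V : lmodType R} {f : U -> V}.
Hypothesis fl : linear f.
Let F : {linear U -> V} := HB.pack f (GRing.isLinear.Build _ _ _ _ f fl).

Lemma linear_funB x y : f (x - y) = f x - f y. Proof. exact: (linearB F). Qed.

Lemma linear_fun0 : f 0 = 0. Proof. exact: (linear0 F). Qed.

Lemma linear_funN x : f (- x) = - f x. Proof. exact: (linearN F). Qed.

End linear_function.

(** * The mixed problem *)

Section admissible_data.
Context {R : realType} {X Y Z : normedModType R} (pi : {linear X -> Z}).
Context {D : mixed_data X Y Z} {h : X -> R} {r alpha c M q m : R}.
Hypothesis adm : admissible D h r alpha c M q m.

Lemma formbB v w l : formb D (v - w) l = formb D v l - formb D w l.
Proof. exact: (linear_funB (b_linearl adm l)). Qed.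

Lemma formbN v l : formb D (- v) l = - formb D v l.
Proof. exact: (linear_funN (b_linearl adm l)). Qed.

Lemma formbBr v l k : formb D v (l - k) = formb D v l - formb D v k.
Proof. exact: (linear_funB (b_linearr adm v)). Qed.

Lemma formJ0 u : formJ D u 0 = 0.
Proof.
by apply/eqP; rewrite -normr_le0 (le_trans (J_bounded adm u 0))// normr0 mulr0.
Qed.

(** The inf-sup condition in the form used to estimate multipliers: the supremum of the quotients
    for [l] is at most [C / |l|]. *)
Lemma inf_sup_bound (C : R) (l : Y) : 0 <= C ->
  (forall v, formb D v l <= C * `|v|) -> alpha * `|l| <= C.
Proof.
move=> C0 bC; have [->|l0] := eqVneq l 0; first by rewrite normr0 mulr0.
have nl : 0 < `|l| by rewrite normr_gt0.
rewrite -ler_pdivlMr// -lee_fin (le_trans (b_inf_sup adm))//.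
apply: (le_trans (ereal_inf_lbound _)); first by exists l.
apply: ge_ereal_sup => _ [v /= v0 <-].
rewrite lee_fin ler_pdivrMr ?mulr_gt0 ?normr_gt0//.
by rewrite (mulrC `|v|) mulrA divfK ?gt_eqF.
Qed.

Lemma A_strongly_monotone u v :
  M * `|v - u| `^ q <= opA D v (v - u) - opA D u (v - u).
Proof. exact: le_trans (h_lower_bound adm _) (h_monotone adm _ _). Qed.

Lemma mixed_solution_direction u l : mixed_solution pi D u l ->
  forall w, rhs D (pi w) <= opA D u w + formb D w l + formJ D u w.
Proof.
by move=> [_ H _] w; have := H (u + w); rewrite addrAC subrr add0r.
Qed.

(* Testing with [w] and [- w] and using (10). *)
Lemma mixed_solution_eq u l : mixed_solution pi D u l ->
  forall w, opA D u w + formb D w l + formJ D u w = rhs D (pi w).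
Proof.
move=> sol w; apply/eqP; rewrite eq_le (mixed_solution_direction sol) andbT.
have := mixed_solution_direction sol (- w); have := J_opp adm u w.
rewrite !linearN/= formbN; lra.
Qed.

(** Each solution is tested with the other. The multiplier inequalities remove the [b] terms, and
    [M > m] forces [u1 = u2]; then [b] agrees at [l1] and [l2] by [mixed_solution_eq], and the
    inf-sup bound with constant 0 gives [l1 = l2]. *)
Lemma mixed_solution_unique u1 l1 u2 l2 :
  mixed_solution pi D u1 l1 -> mixed_solution pi D u2 l2 ->
  u1 = u2 /\ l1 = l2.
Proof.
move=> sol1 sol2; have [L1 _ mult1] := sol1; have [L2 _ mult2] := sol2.
have u12 : u1 = u2.
  apply: contrapT => /eqP ne; have n0 : 0 < `|u2 - u1| `^ q.
    by rewrite powR_gt0// normr_gt0 subr_eq0 eq_sym.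
  have := mixed_solution_direction sol1 (u2 - u1).
  have := mixed_solution_direction sol2 (u1 - u2).
  have := J_relaxed_monotone adm u1 u2.
  have := A_strongly_monotone u1 u2.
  have := mult1 _ L2; have := mult2 _ L1.
  rewrite (distrC u1) !formbBr !formbB !linearB/=.
  have : m * `|u2 - u1| `^ q < M * `|u2 - u1| `^ q.
    by rewrite ltr_pM2r// (m_lt_M adm).
  lra.
split=> //; subst u2; apply/eqP; rewrite -subr_eq0 -normr_le0.
rewrite -(pmulr_rle0 _ (alpha_gt0 adm)); apply: inf_sup_bound => // v.
rewrite mul0r formbBr.
have := mixed_solution_eq sol1 v; have := mixed_solution_eq sol2 v; lra.
Qed.

End admissible_data.

Lemma continuous_linear_bound {R : realType} {X Z : normedModType R}
    (pi : {linear X -> Z}) : continuous pi ->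
  exists2 P : R, 0 <= P & forall x, `|pi x| <= P * `|x|.
Proof.
move=> /linear_bounded_continuous/linear_boundedP/pinfty_ex_gt0[P P0 HP].
by exists P => //; exact: ltW.
Qed.

Lemma opA_bounded {R : realType} {X Y Z : normedModType R}
    {D : mixed_data X Y Z} {h : X -> R} {r alpha c M q m : R} (B : R) :
  admissible D h r alpha c M q m ->
  exists2 C : R, 0 <= C & forall v, `|v| <= B -> `|opA D v| <= C.
Proof.
(* The radius is the absolute value of [B], so that the ball contains 0 whatever the sign of [B]. *)
move=> adm; pose S := [set v : X | `|v| <= `|B|].
have S0 : S 0 by rewrite /S/= normr0.
have [|L L0 AL] := A_locally_lipschitz adm (ex_intro S 0 S0).
  exists `|B|; split; first exact: num_real.
  by move=> N BN v /= vB; exact: le_trans vB (ltW BN).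
exists (`|opA D 0| + L * `|B|) => [|v vB].
  by rewrite addr_ge0// mulr_ge0// ltW.
have vB' : `|v| <= `|B| by rewrite (le_trans vB)// ler_norm.
rewrite -[opA D v](subrK (opA D 0)) addrC (le_trans (ler_normD _ _))// lerD2l.
by rewrite (le_trans (AL _ _ vB' S0))// subr0 ler_wpM2l// ltW.
Qed.

(** * Stability of solutions under perturbation of the data *)

Section stability.
Context {R : realType} {X Y Z : completeNormedModType R}.
Context (pi : {linear X -> Z}) (pi_cont : continuous pi).
Context (D_ : nat -> mixed_data X Y Z) (D : mixed_data X Y Z).
Context (h_ : nat -> X -> R) (r_ alpha_ c_ M_ q_ m_ : nat -> R).
Context (h : X -> R) (r alpha c M q m : R).
Hypothesis adm_ : forall n,
  admissible (D_ n) (h_ n) (r_ n) (alpha_ n) (c_ n) (M_ n) (q_ n) (m_ n).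
Hypothesis adm : admissible D h r alpha c M q m.
Context (u_ : nat -> X) (l_ : nat -> Y).
Hypothesis sol_ : forall n, mixed_solution pi (D_ n) (u_ n) (l_ n).
Context (F delta : nat -> R) (delta_sup : R).
Hypothesis F_delta_ge0 : forall n, 0 <= F n /\ 0 <= delta n.
Hypothesis A_close : forall n v,
  `|opA (D_ n) v - opA D v| <= F n * (`|v| + delta n).
Hypothesis F_cvg0 : F n @[n --> \oo] --> 0.
Hypothesis delta_le : forall n, delta n <= delta_sup.
Hypothesis rhs_cvg : (fun n => rhs (D_ n)) ~~> rhs D.

Lemma opA_seq_bounded (v_ : nat -> X) (B : R) : (forall n, `|v_ n| <= B) ->
  exists2 C : R, 0 <= C & forall n, `|opA (D_ n) (v_ n)| <= C.
Proof.
move=> vB; have [C C0 AC] := opA_bounded B adm.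
have [Fsup F0 FF] := cvg_seq_norm_bound F_cvg0.
have B0 : 0 <= B by exact: le_trans (vB 0%N).
have d0 : 0 <= delta_sup.
  by apply: le_trans (delta_le 0%N); case: (F_delta_ge0 0).
exists (C + Fsup * (B + delta_sup)) => [|n].
  by rewrite addr_ge0// mulr_ge0// addr_ge0.
rewrite -[opA (D_ n) _](subrK (opA D (v_ n))) addrC.
rewrite (le_trans (ler_normD _ _))//.
have [Fn dn] := F_delta_ge0 n.
rewrite lerD// ?AC// (le_trans (A_close _ _))// ler_pM ?addr_ge0//.
  exact: le_trans (ler_norm _) (FF n).
by rewrite lerD.
Qed.

(** On bounded sets the estimate (a) is uniform, so the argument may vary with [n]. *)
Lemma opA_diff_cvg0 (v_ : nat -> X) (B : R) : (forall n, `|v_ n| <= B) ->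
  opA (D_ n) (v_ n) - opA D (v_ n) @[n --> \oo] --> 0.
Proof.
move=> vB; apply/norm_cvg0P.
apply: (@cvg0_norm_le _ _ (fun n => F n * (B + delta_sup))) => [n|].
  rewrite normr_id (le_trans (A_close _ _))// ler_wpM2l ?lerD//.
  by case: (F_delta_ge0 n).
by rewrite -(mul0r (B + delta_sup)); exact: cvgMr_tmp.
Qed.

Lemma opA_seq_cvg (v_ : nat -> X) (v : X) : v_ n @[n --> \oo] --> v ->
  opA (D_ n) (v_ n) @[n --> \oo] --> opA D v.
Proof.
move=> vv; have [B _ vB] := cvg_seq_norm_bound vv.
have -> : (fun n => opA (D_ n) (v_ n)) =
    (fun n => (opA (D_ n) (v_ n) - opA D (v_ n)) + opA D (v_ n)).
  by apply/funext => n; rewrite subrK.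
rewrite -[opA D v]add0r; apply: cvgD; first exact: opA_diff_cvg0 vB.
by apply: (@cvg_comp _ _ _ v_ (opA D)) vv _; exact: A_continuous adm _.
Qed.

Lemma solutions_bounded (M0 c0 alpha0 : R) :
  0 < M0 -> (forall n, M0 <= M_ n - m_ n) -> (forall n, c_ n <= c0) ->
  0 < alpha0 -> (forall n, alpha0 <= alpha_ n) ->
  exists2 B : R, 0 <= B & forall n, `|u_ n| <= B /\ `|l_ n| <= B.
Proof.
move=> M00 MM cc a0 aa.
have [P P0 piP] := continuous_linear_bound pi_cont.
have [Cf Cf0 fC] := weak_cvg_dual_bounded rhs_cvg.
have c00 : 0 <= c0 by rewrite (le_trans (ltW (c_gt0 (adm_ 0%N)))).
have [C0 C00 A0C] : exists2 C : R, 0 <= C & forall n, `|opA (D_ n) 0| <= C.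
  by apply: (@opA_seq_bounded (fun=> 0) 0) => n; rewrite normr0.
have rhs_le n w : `|rhs (D_ n) (pi w)| <= Cf * P * `|w|.
  by rewrite (le_trans (pairing_norm _ _))// -mulrA ler_pM.
have J_le n w1 w2 : formJ (D_ n) w1 w2 <= c0 * `|w2|.
  rewrite (le_trans (ler_norm _))// (le_trans (J_bounded (adm_ n) _ _))//.
  by rewrite ler_wpM2r.
(* The three terms bound the operators at 0, the forms [J] and the right-hand sides. *)
pose C := C0 + c0 + Cf * P.
have u_le n : `|u_ n| <= 1 + C / M0.
  have [u1|u1] := leP `|u_ n| 1.
    by rewrite (le_trans u1)// lerDl divr_ge0 ?(ltW M00)// !addr_ge0// mulr_ge0.
  rewrite (@le_trans _ _ (C / M0)) ?lerDr// ler_pdivlMr//.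
  rewrite -(ler_pM2r (lt_trans ltr01 u1)).
  have [L _ /(_ 0 (multipliers0 (adm_ n)))] := sol_ n.
  rewrite sub0r (linear_funN (b_linearr (adm_ n) _)) => bn.
  have := mixed_solution_direction (sol_ n) (- u_ n).
  rewrite (formbN (adm_ n)) !linearN/= => dn.
  have := A_strongly_monotone (adm_ n) 0 (u_ n); rewrite subr0 => An.
  have := rhs_le n (u_ n); rewrite ler_norml => /andP[_ fn].
  have := J_le n (u_ n) (- u_ n); rewrite normrN => Jn.
  have := le_trans (pairing_norm (opA (D_ n) 0) (u_ n)) (ler_wpM2r _ (A0C n)).
  rewrite normr_ge0 => /(_ isT); rewrite ler_norml => /andP[A0n _].
  (* For norms above 1 every exponent [q_ n >= 2] can be lowered to 2, which makes the bound uniform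
     in [n]. *)
  have pn : `|u_ n| * `|u_ n| <= `|u_ n| `^ q_ n.
    by rewrite -expr2 -powR_mulrn// ler_powR ?(q_ge2 (adm_ n))// ltW.
  have Mn : M0 * (`|u_ n| * `|u_ n|) <= M_ n * `|u_ n| `^ q_ n.
    rewrite ler_pM ?mulr_ge0 ?(ltW M00)// (le_trans (MM n))// gerBl.
    exact: m_ge0 (adm_ n).
  rewrite mulrAC [_ * _ * M0]mulrC /C; move: Mn An dn bn fn Jn A0n.
  rewrite !mulrDl; lra.
have [C1 C10 AuC] := opA_seq_bounded u_le.
(* With the operators bounded along [u_], the inequality tested with [- v] bounds [b (v, l_n)] and
   the inf-sup condition applies. *)
have l_le n : `|l_ n| <= (C1 + c0 + Cf * P) / alpha0.
  rewrite ler_pdivlMr// mulrC.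
  rewrite (@le_trans _ _ (alpha_ n * `|l_ n|)) ?ler_wpM2r//.
  apply: (inf_sup_bound (adm_ n)) => [|v]; first by rewrite !addr_ge0// mulr_ge0.
  have := mixed_solution_direction (sol_ n) (- v).
  rewrite (formbN (adm_ n)) !linearN/=.
  have := rhs_le n v; rewrite ler_norml => /andP[_].
  have := J_le n (u_ n) (- v); rewrite normrN.
  have := le_trans (pairing_norm (opA (D_ n) (u_ n)) v) (ler_wpM2r _ (AuC n)).
  rewrite normr_ge0 => /(_ isT); rewrite ler_norml => /andP[].
  rewrite !mulrDl; lra.
exists (Num.max (1 + C / M0) ((C1 + c0 + Cf * P) / alpha0)) => [|n].
  by rewrite le_max (le_trans _ (u_le 0%N)).
by rewrite !le_max u_le l_le orbT.
Qed.

Context (u0 : X) (l0 : Y).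
Hypothesis u_weak : u_ ~~> u0.
Hypothesis l_weak : l_ ~~> l0.
Hypothesis pi_compact : forall (v_ : nat -> X) (v : X),
  v_ ~~> v -> pi (v_ n) @[n --> \oo] --> pi v.
Hypothesis J_close : forall v : X, (limn_esup (fun n =>
  (formJ (D_ n) (u_ n) (v - u_ n)%R - formJ D (u_ n) (v - u_ n)%R)%:E) <= 0)%E.
Hypothesis b_limsup : forall (z_ : nat -> X) (z : X) (mu_ : nat -> Y) (mu : Y),
  z_ ~~> z -> mu_ ~~> mu -> forall w : X,
  (limn_esup (fun n => (formb (D_ n) (w - z_ n)%R (mu_ n))%:E)
    <= (formb D (w - z)%R mu)%:E)%E.

Lemma subr_weak v : (fun n => v - u_ n) ~~> v - u0.
Proof. by apply: weak_cvgB u_weak; exact: weak_cvg_cst. Qed.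

Lemma rhs_pairing_cvg v :
  rhs (D_ n) (pi (v - u_ n)) @[n --> \oo] --> rhs D (pi (v - u0)).
Proof.
have [C _ fC] := weak_cvg_dual_bounded rhs_cvg.
apply: (cvg_bounded_pairing fC); first exact: weak_cvg_dual_pointwise.
apply: pi_compact; exact: subr_weak.
Qed.

Lemma formJ_limsup v e : 0 < e ->
  \forall n \near \oo, formJ (D_ n) (u_ n) (v - u_ n) < formJ D u0 (v - u0) + e.
Proof.
move=> e0; have e20 : 0 < e / 2 by rewrite divr_gt0.
have := limn_esup_near (J_limsup adm u_weak (@subr_weak v)) e20.
have := limn_esup_near (J_close v) e20.
apply: filterS2 => n; lra.
Qed.

(* Only the monotonicity of the limit operator enters here: the exponents [q_]
   may be unbounded, so those of the operators [opA (D_ n)] would not force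
   convergence. *)
Lemma solutions_cvg (B : R) : (forall n, `|u_ n| <= B) ->
  u_ n @[n --> \oo] --> u0.
Proof.
move=> uB; apply/cvgrPdist_lt => e e0.
have q0 : 0 < q by rewrite (lt_le_trans _ (q_ge2 adm)).
(* Below this threshold [M |u0 - u_n|^q] forces [|u0 - u_n| < e]. Five error terms get [t / 5] each:
   the operator difference, [A u0], the right-hand side, [b] and [J]. *)
pose t := M * e `^ q.
have t0 : 0 < t by rewrite mulr_gt0 ?powR_gt0// (M_gt0 adm).
have t50 : 0 < t / 5 by rewrite divr_gt0.
have A_diff : (opA (D_ n) (u_ n) - opA D (u_ n)) (u0 - u_ n) @[n --> \oo] --> 0.
  have -> : 0 = (0 : rdual X) (u0 - u0) by [].
  apply: (@cvg_pairing_weak _ _ _ _ _ _ (`|u0| + B)) => [n||].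
  - by rewrite (le_trans (ler_normB _ _))// lerD2l.
  - exact: opA_diff_cvg0 uB.
  - exact: subr_weak.
have A0 : opA D u0 (u0 - u_ n) @[n --> \oo] --> 0.
  by have := @subr_weak u0 (opA D u0); rewrite subrr linear0.
have f0 : rhs (D_ n) (pi (u0 - u_ n)) @[n --> \oo] --> 0.
  by have := @rhs_pairing_cvg u0; rewrite subrr !linear0.
have b0 := limn_esup_near (b_limsup u_weak l_weak u0) t50.
have J0 := formJ_limsup u0 t50.
move/cvgrPdist_lt : A_diff => /(_ _ t50) A_diff.
move/cvgrPdist_lt : A0 => /(_ _ t50) A0.
move/cvgrPdist_lt : f0 => /(_ _ t50) f0.
near=> n.
have : M * `|u0 - u_ n| `^ q < t.
  rewrite (le_lt_trans (A_strongly_monotone adm (u_ n) u0))//.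
  have := mixed_solution_direction (sol_ n) (u0 - u_ n).
  have : `|0 - (opA (D_ n) (u_ n) - opA D (u_ n)) (u0 - u_ n)| < t / 5.
    by near: n.
  have : `|0 - opA D u0 (u0 - u_ n)| < t / 5 by near: n.
  have : `|0 - rhs (D_ n) (pi (u0 - u_ n))| < t / 5 by near: n.
  have : formJ (D_ n) (u_ n) (u0 - u_ n) < formJ D u0 (u0 - u0) + t / 5.
    by near: n.
  have : formb (D_ n) (u0 - u_ n) (l_ n) < formb D (u0 - u0) l0 + t / 5.
    by near: n.
  rewrite -[(opA (D_ n) _ - _) _]/(opA (D_ n) (u_ n) _ - opA D (u_ n) _).
  rewrite !sub0r !normrN !ltr_norml subrr (formJ0 adm).
  rewrite (linear_fun0 (b_linearl adm _)).
  set a := opA D u0 _. set b := opA D (u_ n) _. set a' := opA (D_ n) _ _.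
  lra.
rewrite ltr_pM2l ?(M_gt0 adm)//; apply: contraTT; rewrite -!leNgt => eu.
by rewrite ge0_ler_powR ?nnegrE ?(ltW q0) ?(ltW e0).
Unshelve. all: by end_near. Qed.

(** Mosco convergence puts [l0] in the limit set and supplies strongly convergent test multipliers;
    each inequality is then read off, up to [e], at a single large index. *)
Lemma limit_is_solution :
  mosco_cvg (fun n => multipliers (D_ n)) (multipliers D) ->
  u_ n @[n --> \oo] --> u0 -> mixed_solution pi D u0 l0.
Proof.
move=> [mosco1 mosco2] u_cvg; split.
- by apply: mosco2 l_weak => n; case: (sol_ n).
- move=> v; apply/ler_addgt0Pr => e e0.
  have e40 : 0 < e / 4 by rewrite divr_gt0.
  have A_cvg : opA (D_ n) (u_ n) (v - u_ n) @[n --> \oo] --> opA D u0 (v - u0).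
    have v_cvg : v - u_ n @[n --> \oo] --> v - u0.
      by apply: cvgB => //; exact: cvg_cst.
    have [C _ vC] := cvg_seq_norm_bound v_cvg.
    by apply: (cvg_pairing_weak vC (opA_seq_cvg u_cvg)); exact: subr_weak.
  have f_cvg := @rhs_pairing_cvg v.
  have b_lt := limn_esup_near (b_limsup u_weak l_weak v) e40.
  have J_lt := formJ_limsup v e40.
  move/cvgrPdist_lt : A_cvg => /(_ _ e40) A_lt.
  move/cvgrPdist_lt : f_cvg => /(_ _ e40) f_lt.
  have [n [[bn Jn] [An fn]]] :=
    filter_ex (filterI (filterI b_lt J_lt) (filterI A_lt f_lt)).
  have := mixed_solution_direction (sol_ n) (v - u_ n).
  move: bn Jn An fn; rewrite /= !ltr_norml; lra.
- move=> mu Lmu; have [mu_ Lmu_ mu_cvg] := mosco1 mu Lmu.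
  have mul_weak : (fun n => mu_ n - l_ n) ~~> mu - l0.
    by apply: weak_cvgB l_weak; exact: cvg_weak_cvg.
  apply/ler_addgt0Pr => e e0; rewrite add0r.
  (* With [w = 0], the upper limit in (f) of the forms at [- u_n] becomes a lower limit for
     [b (u_n, mu_n - l_n) <= 0]. *)
  have := filter_ex (limn_esup_near (b_limsup u_weak mul_weak 0) e0).
  rewrite !sub0r => -[n]; rewrite !sub0r (formbN (adm_ n)) (formbN adm).
  have [_ _ /(_ _ (Lmu_ n))] := sol_ n; lra.
Qed.

End stability.

(** * Minimizing sequences and existence of a minimizer *)

Lemma near_subsequence (k : nat -> nat) (P : nat -> Prop) :
  (forall n, n <= k n)%N -> (\forall n \near \oo, P n) ->
  \forall n \near \oo, P (k n).
Proof.
move=> nk [N _ NP]; exists N => // n /= Nn.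
by apply: NP => /=; exact: leq_trans (nk n).
Qed.

(** Comparing with each [f p] instead of an infimum also covers [f] unbounded below, where values
    under [- n] are chosen. *)
Lemma minimizing_sequence {R : realType} {T : Type} (U : set T) (f : T -> R) :
  U !=set0 -> exists2 p_ : nat -> T, forall n, U (p_ n) &
  forall p, U p -> forall e, 0 < e -> \forall n \near \oo, f (p_ n) < f p + e.
Proof.
move=> [p1 Up1]; have [lb|nlb] := pselect (has_lbound [set f p | p in U]).
  have /choice[p_ pP] : forall n,
      exists p, U p /\ f p < inf [set f p | p in U] + n.+1%:R^-1.
    move=> n.
    have [||_ [p Up <-] lt] := @inf_adherent R [set f p | p in U] n.+1%:R^-1.
    - by rewrite invr_gt0.
    - by split => //; exists (f p1), p1.
    - by exists p.
  exists p_ => [n|p Up e e0]; first by have [] := pP n.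
  near=> n; have [_ /lt_le_trans] := pP n; apply; rewrite lerD//.
    by apply: ge_inf => //; exists p.
  by apply: ltW; near: n; exact: (near_infty_natSinv_lt (PosNum e0)).
have /choice[p_ pP] : forall n : nat, exists p, U p /\ f p < - n%:R.
  move=> n; apply: contrapT => /forallNP H; apply: nlb; exists (- n%:R).
  move=> _ [p Up <-]; rewrite leNgt; apply/negP => fp; exact: (H p).
exists p_ => [n|p Up e e0]; first by have [] := pP n.
near=> n; have [_ /lt_trans] := pP n; apply.
rewrite ltrNl; near: n; exact: nbhs_infty_gtr.
Unshelve. all: by end_near. Qed.

Lemma cvg_norm_pinfty {R : realType} {K : numFieldType} (s : scalar_field R K)
    {W : normedModType K} (p_ : nat -> W) :
  (forall n, n%:R < rnorm s (p_ n)) -> `|p_ n| @[n --> \oo] --> +oo.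
Proof.
move=> np A [M [Mreal MA]].
have : \forall n \near \oo, modulus s M < n%:R :> R by exact: nbhs_infty_gtr.
apply: filterS => n Mn; apply: MA.
rewrite (le_lt_trans (real_ler_norm Mreal))//.
by rewrite -(modulusK s) -(real_scalar_rnorm s) ltr_real_scalar (lt_trans Mn).
Qed.

Theorem theorem5 (R : realType) (K : numFieldType) (s : scalar_field R K)
    (X Y Z : completeNormedModType R) (W : completeNormedModType K)
    (U : set W) (pi : {linear X -> Z})
    (D : W -> mixed_data X Y Z) (h : W -> X -> R) (r alpha c M q m : W -> R)
    (u : W -> X) (lam : W -> Y) (L : X -> Y -> W -> R) :
  reflexive_space (RealScalars R) X ->
  reflexive_space (RealScalars R) Y ->
  reflexive_space (RealScalars R) Z ->
  reflexive_space s W ->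
  U !=set0 ->
  closed (U : set (weak_space s W)) ->
  continuous pi ->
  (forall (v_ : nat -> X) (v : X), v_ ~~> v -> pi (v_ n) @[n --> \oo] --> pi v) ->
  (forall p, U p ->
    admissible (D p) (h p) (r p) (alpha p) (c p) (M p) (q p) (m p)) ->
  (forall p, U p -> mixed_solution pi (D p) (u p) (lam p)) ->
  (forall (u_ : nat -> X) (lam_ : nat -> Y) (p_ : nat -> W) u0 lam0 p,
    (forall n, U (p_ n)) -> u_ n @[n --> \oo] --> u0 -> lam_ ~~> lam0 ->
    weak_cvg s p_ p ->
    ((L u0 lam0 p)%:E <= limn_einf (fun n => (L (u_ n) (lam_ n) (p_ n))%:E))%E) ->
  (exists2 psi : W -> R,
     forall u0 lam0 p, U p -> psi p <= L u0 lam0 p &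
     forall p_ : nat -> W, (forall n, U (p_ n)) ->
       `|p_ n| @[n --> \oo] --> +oo -> psi (p_ n) @[n --> \oo] --> +oo)
    \/ bounded_set U ->
  (forall (p_ : nat -> W) (p : W), (forall n, U (p_ n)) -> weak_cvg s p_ p ->
    (* (a) *)
    (exists (delta_sup : R) (F delta : nat -> R),
       [/\ forall n, 0 <= F n /\ 0 <= delta n,
           forall n (v : X), `|opA (D (p_ n)) v - opA (D p) v|
             <= F n * (`|v| + delta n),
           F n @[n --> \oo] --> 0
         & forall n, delta n <= delta_sup]) /\
    (* (b) *)
    ((forall w : X, lower_semicontinuous
       ((fun v => (formJ (D p) w v)%:E) : weak_space (RealScalars R) X -> \bar R)) /\
     (forall (w_ : nat -> X) (w : X), w_ ~~> w ->
       (limn_esup (fun n =>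
          (formJ (D p) w (w_ n - w)%R - formJ (D (p_ n)) w (w_ n - w)%R)%:E)
        <= 0)%E /\
       (forall v : X, (limn_esup (fun n =>
          (formJ (D (p_ n)) (w_ n) (v - w_ n)%R
           - formJ (D p) (w_ n) (v - w_ n)%R)%:E) <= 0)%E))) /\
    (* (c) *)
    (exists2 M0 : R, 0 < M0 & forall n, M0 <= M (p_ n) - m (p_ n)) /\
    (* (d) *)
    (exists2 q0 : R, 0 < q0 & forall n, q0 <= q (p_ n)) /\
    (* (e) *)
    (exists c0 : R, forall n, c (p_ n) <= c0) /\
    (* (f) *)
    (forall (z_ : nat -> X) (z : X) (mu_ : nat -> Y) (mu : Y),
       z_ ~~> z -> mu_ ~~> mu -> forall w : X,
       (limn_esup (fun n => (formb (D (p_ n)) (w - z_ n)%R (mu_ n))%:E)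
        <= (formb (D p) (w - z)%R mu)%:E)%E) /\
    (* (g) *)
    (exists2 alpha0 : R, 0 < alpha0 & forall n, alpha0 <= alpha (p_ n)) /\
    (* (h) *)
    mosco_cvg (fun n => multipliers (D (p_ n))) (multipliers (D p)) /\
    (* (i) *)
    (fun n => rhs (D (p_ n))) ~~> rhs (D p)) ->
  exists2 p' : W, U p' &
    forall p, U p -> L (u p') (lam p') p' <= L (u p) (lam p) p.
Proof.
move=> reflX reflY reflZ reflW U0 Uclosed pi_cont pi_compact.
move=> adm sol L_lsc bnd hyp.
pose f p := L (u p) (lam p) p.
have [p1_ Up1 min1] := @minimizing_sequence R W U f U0.
have [B [N pB]] : exists (B : R) (N : nat),
    forall n, rnorm s (p1_ (n + N)%N) <= B.
  have [[psi psiL psi_cvg]|/pinfty_ex_gt0[B B0 UB]] := bnd; last first.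
    exists (modulus s B), 0%N => n.
    rewrite -(ler_real_scalar s) real_scalar_rnorm.
    rewrite (real_scalar_nonneg s (ltW B0)).
    by apply: UB; exact: Up1.
  (* Otherwise a subsequence has norms tending to infinity, so [psi] and with it the cost tend to
     infinity, against minimality. *)
  apply: contrapT => unbounded.
  have /choice[k kP] : forall n : nat,
      exists j, (n <= j)%N /\ n%:R < rnorm s (p1_ j).
    move=> n; apply: contrapT => /forallNP H.
    apply: unbounded; exists n%:R, n => j.
    by rewrite leNgt; apply/negP => nj; apply: (H (j + n)%N); rewrite leq_addl.
  have psi_oo : psi (p1_ (k n)) @[n --> \oo] --> +oo.
    apply: (psi_cvg (p1_ \o k)) => [n|]; first exact: Up1.
    by apply: (@cvg_norm_pinfty _ _ s) => n; have [] := kP n.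
  have [p Up] := U0.
  have := near_subsequence (fun n => (kP n).1) (min1 p Up 1 ltr01).
  move/cvgryPge : psi_oo => /(_ (f p + 1)) psi_ge f_lt.
  have [n [/= pn fn]] := filter_ex (filterI psi_ge f_lt).
  by have := le_lt_trans (le_trans pn (psiL _ _ _ (Up1 _))) fn; rewrite ltxx.
have [|k2 [p [k2n p2_weak]]] := @weak_sequential_compactness
    R K s W reflW (fun n => p1_ (n + N)%N) B.
  by move=> n; rewrite -(real_scalar_rnorm s) ler_real_scalar.
pose k12 n := (k2 n + N)%N.
have k12n n : (n <= k12 n)%N by rewrite (leq_trans (k2n n))// leq_addr.
pose p2_ := p1_ \o k12; have Up2 n : U (p2_ n) by exact: Up1.
have {}p2_weak : weak_cvg s p2_ p by exact: p2_weak.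
have Up : U p.
  have /weak_cvgE := p2_weak.
  exact: (closed_cvg (V := weak_space s W) U Uclosed (nearW _ Up2)).
(* This first use of the hypotheses, along [p2_], yields the bounds on the solutions needed to
   extract further. *)
have [[ds [F [d [Fd AF F0 dle]]]] [_ [[M0 M00 MM] [_ [[c0 cc]
  [_ [[a0 a00 aa] [_ fcvg]]]]]]]] := hyp p2_ p Up2 p2_weak.
have [C C0 ulC] := solutions_bounded pi_cont (fun n => adm _ (Up2 n)) (adm _ Up)
  (fun n => sol _ (Up2 n)) Fd AF F0 dle fcvg M00 MM cc a00 aa.
have [|k3 [u0 [k3n u0_weak]]] := @weak_sequential_compactness
    R R (RealScalars R) X reflX (u \o p2_) C.
  by move=> n; have [] := ulC n.
have [|k4 [l0 [k4n l0_weak]]] := @weak_sequential_compactness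
    R R (RealScalars R) Y reflY (lam \o p2_ \o k3) C.
  by move=> n; have [] := ulC (k3 n).
have k34n n : (n <= k3 (k4 n))%N by rewrite (leq_trans (k4n n)).
pose p4_ := p2_ \o (k3 \o k4); have Up4 n : U (p4_ n) by exact: Up2.
have p4_weak : weak_cvg s p4_ p by exact: weak_cvg_comp.
have {}u0_weak : u \o p4_ ~~> u0 by exact: (weak_cvg_comp k4n u0_weak).
have {}l0_weak : lam \o p4_ ~~> l0 by exact: l0_weak.
(* The hypotheses concern whole sequences, so they are invoked again along the final subsequence
   [p4_]. *)
have {Fd AF F0 dle fcvg} [[ds' [F' [d' [Fd AF F0 dle]]]]
  [[_ J_close] [_ [_ [_ [b_limsup [_ [mosco fcvg]]]]]]]] := hyp p4_ p Up4 p4_weak.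
have sol4 n := sol _ (Up4 n).
have J_close4 := (J_close _ _ u0_weak).2.
have u_cvg : u (p4_ n) @[n --> \oo] --> u0.
  by apply: (solutions_cvg (adm _ Up) sol4 Fd AF F0 dle fcvg u0_weak l0_weak
    pi_compact J_close4 b_limsup (B := C)) => n; have [] := ulC (k3 (k4 n)).
have [eu el] : u0 = u p /\ l0 = lam p.
  apply: (mixed_solution_unique (adm _ Up) _ (sol _ Up)).
  exact: (limit_is_solution (fun n => adm _ (Up4 n)) (adm _ Up) sol4 Fd AF F0 dle
    fcvg u0_weak l0_weak pi_compact J_close4 b_limsup mosco u_cvg).
(* At one large index of [p4_], lower semicontinuity and minimality each lose at most [e / 2]. *)
subst u0 l0; exists p => // p' Up'; apply/ler_addgt0Pr => e e0.
have e20 : 0 < e / 2 by rewrite divr_gt0.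
have k14n n : (n <= k12 (k3 (k4 n)))%N by rewrite (leq_trans (k34n n)).
have f_lt := near_subsequence k14n (min1 p' Up' _ e20).
have f_gt := limn_einf_near (L_lsc _ _ _ _ _ _ Up4 u_cvg l0_weak p4_weak) e20.
have [n [/= lt gt]] := filter_ex (filterI f_lt f_gt).
by move: lt gt; rewrite /f /p4_ /p2_ /=; lra.
Qed.
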